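(* Let $n\ge 5$ be an integer and let $C_{n-2}=\frac{1}{n-1}\binom{2(n-2)}{n-2}$. There exists an enumeration $v_1,\dots,v_{C_{n-2}}$ of the vertices of the associahedron $\mathrm{Assoc}_{n-3}$ such that, for every $i=1,\dots,C_{n-2}$ (with the convention $v_{C_{n-2}+1}=v_1$), the open segment $v_iv_{i+1}$ lies within the interior of $\mathrm{Assoc}_{n-3}$.
   Context: Fix a convex $n$-gon with vertex set $[n]$ in cyclic order. Its diagonals are the pairs $\{i,j\}\subset[n]$ with $i-j\not\equiv 0,\pm1\pmod n$. A triangulation is identified with its set of $n-3$ pairwise noncrossing diagonals; there are $C_{n-2}$ triangulations. The associahedron $\mathrm{Assoc}_{n-3}$ is an $(n-3)$-dimensional convex polytope whose vertices correspond bijectively to the triangulations of the $n$-gon and whose facets correspond bijectively to the diagonals of the $n$-gon, in such a way that the vertex corresponding to a triangulation $T$ lies on the facet corresponding to a diagonal $d$ if and only if $d\in T$. Its $1$-skeleton is the flip graph, in which two triangulations are adjacent if and only if one is obtained from the other by replacing a single diagonal by the other diagonal of the quadrilateral formed by the two triangles containing it. The interior is the interior of the polytope relative to its $(n-3)$-dimensional affine hull. *)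

(* Defs.v *)
From mathcomp Require Import all_boot all_order all_algebra.
From mathcomp Require Import all_classical all_reals all_analysis.

Set Implicit Arguments.
Unset Strict Implicit.
Unset Printing Implicit Defensive.

Import Order.TTheory GRing.Theory Num.Theory.
Import numFieldNormedType.Exports.

(** ** Triangulations of the convex n-gon

    The vertices of the n-gon are the elements 0, ..., n-1 of ['I_n] in cyclic
    order, and a diagonal is the two-element set of its endpoints. *)

Definition is_diagonal n (D : {set 'I_n}) : bool :=
  [exists i : 'I_n, exists j : 'I_n,
    [&& D == [set i; j]%SET, i != j %[mod n],
        i != j.+1 %[mod n] & i.+1 != j %[mod n]]].

Definition diagonals n : {set {set 'I_n}} := [set D | is_diagonal D]%SET.

(** Two diagonals of a convex polygon cross, i.e. have a common interior point,
    when their endpoints are four distinct vertices that alternate around the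
    polygon. *)
Definition alternate n (D E : {set 'I_n}) : bool :=
  [exists i : 'I_n, exists j : 'I_n, exists k : 'I_n, exists l : 'I_n,
    [&& i < j, j < k, k < l, D == [set i; k]%SET & E == [set j; l]%SET]].

Definition crossing n (D E : {set 'I_n}) : bool :=
  alternate D E || alternate E D.

Definition is_triangulation n (T : {set {set 'I_n}}) : bool :=
  [&& T \subset diagonals n, #|T| == n - 3
    & [forall D in T, forall E in T, ~~ crossing D E]].

Definition triangulations n : {set {set {set 'I_n}}} :=
  [set T | is_triangulation T]%SET.

(** The division is exact. *)
Definition catalan m : nat := 'C(2 * m, m) %/ m.+1.

(** ** Convex polytopes *)

Local Open Scope classical_set_scope.
Local Open Scope ring_scope.

Section Polytopes.
Variables (R : realType) (d : nat).
Implicit Types (A P F : set 'rV[R]_d) (x y : 'rV[R]_d).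

Definition affine_hull A : set 'rV[R]_d :=
  [set x | exists (k : nat) (p : 'I_k -> 'rV[R]_d) (w : 'I_k -> R),
    [/\ forall i, A (p i), \sum_i w i = 1 & x = \sum_i w i *: p i]].

Definition convex_hull A : set 'rV[R]_d :=
  [set x | exists (k : nat) (p : 'I_k -> 'rV[R]_d) (w : 'I_k -> R),
    [/\ forall i, A (p i), forall i, 0 <= w i,
        \sum_i w i = 1 & x = \sum_i w i *: p i]].

Definition polytope P : Prop := exists2 A, finite_set A & P = convex_hull A.

(** The affine hull of [A] is a translate of an [m]-dimensional linear
    subspace; in particular no [m] qualifies when [A] is empty. *)
Definition has_dim A (m : nat) : Prop :=
  exists (x : 'rV[R]_d) (U : {vspace 'rV[R]_d}),
    affine_hull A = [set x + u | u in [set` U]] /\ \dim U = m.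

(** The linear functional is [fun x => (x *m c) 0 0]; taking [c = 0] one gets
    [P] itself and the empty set among the faces of [P]. *)
Definition face P F : Prop :=
  exists (c : 'cV[R]_d) (b : R),
    (forall x, P x -> (x *m c) 0 0 <= b) /\
    F = [set x | P x /\ (x *m c) 0 0 = b].

Definition vertices P : set 'rV[R]_d := [set x | face P [set x]].

Definition facets P : set (set 'rV[R]_d) :=
  [set F | face P F /\ exists m, has_dim P m.+1 /\ has_dim F m].

(** Interior of [P] for the topology induced on its affine hull. *)
Definition relative_interior P : set 'rV[R]_d :=
  [set x | P x /\ within (affine_hull P) (nbhs x) P].

Definition open_segment x y : set 'rV[R]_d :=
  [set (1 - t) *: x + t *: y | t in `]0, 1[].

End Polytopes.

(** [P] is a realization of the associahedron of the n-gon; the ambient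
    dimension [d] may exceed the dimension [n - 3] of [P]. *)
Definition is_associahedron (R : realType) (d n : nat)
    (P : set 'rV[R]_d) : Prop :=
  [/\ polytope P, has_dim P (n - 3) &
    exists (vtx : {set {set 'I_n}} -> 'rV[R]_d)
           (fct : {set 'I_n} -> set 'rV[R]_d),
      [/\ set_bij [set` triangulations n] (vertices P) vtx,
          set_bij [set` diagonals n] (facets P) fct &
          forall (T : {set {set 'I_n}}) (D : {set 'I_n}),
            T \in triangulations n -> D \in diagonals n ->
            (fct D (vtx T) <-> D \in T)]].

(* Main.v *)
Require Import Defs.
From mathcomp Require Import all_boot all_order all_algebra all_fingroup.
From mathcomp Require Import all_classical all_reals all_analysis.
From mathcomp Require Import zify lra ring.

Set Implicit Arguments.
Unset Strict Implicit.
Unset Printing Implicit Defensive.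

Import Order.TTheory GRing.Theory Num.Theory.
Import numFieldNormedType.Exports.

(** Two vertices of the associahedron span a segment through its interior as
    soon as their triangulations have no diagonal in common. Indeed a point of a
    polytope outside the relative interior lies on a facet
    ([boundary_in_facet]); a facet that meets an open segment of the polytope
    contains both ends ([face_open_segment]); and a facet through two vertices
    is a diagonal shared by their triangulations. What is needed is therefore a
    Hamiltonian cycle in the graph whose edges are the pairs of disjoint
    triangulations ([hamiltonian_cycle]), together with the fact that there are
    [catalan (n - 2)] triangulations ([card_triangulations]).

    Turning the polygon by one step sends every diagonal to one that crosses it,
    so a triangulation is disjoint from its image: the orbits of the rotation
    [rho] are closed walks in the disjointness graph. These orbits are merged one
    after the other along flips. If [T] and [T'] differ by a flip, then [T] is
    disjoint from the image of [T'] or [T'] is disjoint from the image of [T]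
    ([flip_disjoint]). In both cases some [y] in the orbit of [T'] is disjoint
    from [T], hence [rho y] from [rho T], and trading the edges [T -- rho T] and
    [y -- rho y] for [T -- y] and [rho T -- rho y] joins the two orbits into a
    single cycle. Flips connect all triangulations ([flip_toward_fan]), so every
    orbit can be reached.

    Each merger uses up one edge of each of the two orbits, and the edge may be
    moved along the orbit at will. The process thus never gets stuck if an orbit
    of length [m] has at most [m] neighbouring orbits under flips. This holds
    because a pair (triangulation, diagonal of it) has [n] distinct images under
    rotation unless the diagonal is a diameter, there are only [m * (n - 3)]
    such pairs in the orbit, and a triangulation contains at most one diameter
    ([card_nbr_orbits]).

    Flips are treated as exchanges of one diagonal. That the diagonal removed
    determines the flip, and that exchanges lead to a fan, follow from the bound
    of [n - 3] on the size of a noncrossing set of diagonals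
    ([card_noncrossing]). The same splitting of a polygon at the apex of the
    triangle on one of its sides gives this bound and the Catalan recurrence for
    the number of triangulations. *)

(** * Cyclic sequences *)

Section CyclicSequences.
Variable V : eqType.
Implicit Types (x y z w : V) (c s q : seq V) (e : rel V).

(** The pairs of cyclically consecutive entries, the last one being followed by
    the first. *)
Definition steps c := zip c (rot 1 c).
Definition linked c x y := ((x, y) \in steps c) || ((y, x) \in steps c).

Lemma steps_cons z s :
  steps (z :: s) = rcons (zip (belast z s) s) (last z s, z).
Proof.
rewrite /steps rot1_cons; move: {2 5}z => w.
by elim: s z => [|y s IH] z //=; rewrite IH.
Qed.

Lemma steps_cat z s q :
  steps (z :: s ++ q) =
  zip (belast z s) s ++ rcons (zip (belast (last z s) q) q) (last (last z s) q, z).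
Proof.
by rewrite steps_cons belast_cat zip_cat ?size_belast // last_cat rcons_cat.
Qed.

Lemma steps_rot i c : steps (rot i c) = rot i (steps c).
Proof.
rewrite /steps rot_rot.
rewrite -{1}(@unzip1_zip _ _ c (rot 1 c)) ?size_rot //.
rewrite -{2}(@unzip2_zip _ _ c (rot 1 c)) ?size_rot //.
by rewrite -!map_rot zip_unzip.
Qed.

Lemma steps_rev c x y : ((x, y) \in steps (rev c)) = ((y, x) \in steps c).
Proof.
rewrite /steps -rev_rotr -rev_zip ?size_rotr // mem_rev.
have -> : zip c (rot 1 c) = rot 1 (zip (rotr 1 c) c).
  by have := steps_rot 1 (rotr 1 c); rewrite /steps rotrK.
rewrite mem_rot; move: (rotr 1 c) => d; elim: c d => [|a c IH] [|b d] //=.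
by rewrite !in_cons IH !xpair_eqE andbC.
Qed.

Lemma steps_open c z w :
  (w, z) \in steps c -> exists i s, rot i c = z :: s /\ last z s = w.
Proof.
move=> wz; set st := steps c in wz; have sz : size st = size c.
  by rewrite /st /steps size1_zip // size_rot.
have ltic : index (w, z) st < size c by rewrite -sz index_mem.
exists (index (w, z) st).+1.
have [] : nth w c (index (w, z) st) = w /\
          nth z (rot 1 c) (index (w, z) st) = z.
  have := nth_index (w, z) wz.
  by rewrite {1}/st /steps nth_zip ?size_rot // => -[].
move: (index _ _) ltic => i ltic ci ci1.
case: (ltnP i.+1 (size c)) => lti.
  exists (behead (rot i.+1 c)); move: ci1.
  rewrite {1}/rot nth_cat size_drop ltn_subRL add1n lti nth_drop add1n => ci1.
  rewrite /rot (drop_nth z) // ci1 /= last_cat; split=> //.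
  by rewrite (take_nth w) // ci last_rcons.
have ei : i.+1 = size c by apply/eqP; rewrite eqn_leq ltic.
rewrite ei rot_size; case: c ltic ci ci1 ei {st wz lti sz} => // a c _ ci ci1 [ei].
exists c; move: ci1; rewrite rot1_cons nth_rcons ei ltnn eqxx => az; subst a.
by split=> //; rewrite -ci ei (last_nth w).
Qed.

(** After a rotation of the sequence, and a reversal if [w] comes right after
    [z], the link between [z] and [w] is the one that closes up the cycle; it can
    then be opened by appending further entries. *)
Lemma linked_open c z w : linked c z w -> exists s,
  [/\ perm_eq (z :: s) c, last z s = w,
      linked (z :: s) =2 linked c
    & forall e, symmetric e -> path.cycle e (z :: s) = path.cycle e c].
Proof.
have linked_rot i d : linked (rot i d) =2 linked d.
  by move=> x y; rewrite /linked !steps_rot !mem_rot.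
case/orP => [|zw]; last first.
  have [i [s [es ls]]] := steps_open zw; exists s; rewrite -es perm_rot.
  by split=> // e _; rewrite rot_cycle.
rewrite -steps_rev => /steps_open[i [s [es ls]]]; exists s; rewrite -es.
split=> //.
- by rewrite perm_rot perm_rev.
- by move=> x y; rewrite linked_rot /linked !steps_rev orbC.
by move=> e se; rewrite rot_cycle rev_cycle; apply: eq_cycle => x y /=.
Qed.

(** The link between [z] and [w] is given up for a detour through [y :: q], and
    no other link of [c] is lost. *)
Lemma linked_detour c z w e y q :
    symmetric e -> path.cycle e c -> linked c z w ->
    path e w (y :: q) -> e (last y q) z ->
  exists c', [/\ perm_eq c' (c ++ (y :: q)), path.cycle e c',
    forall a b, linked c a b ->
      [\/ linked c' a b, (a, b) = (z, w) | (a, b) = (w, z)]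
    & forall a b, (a, b) \in zip (belast y q) q -> linked c' a b].
Proof.
move=> se cyc /linked_open[s [pc ls lk ce]] pq lq.
exists (z :: s ++ y :: q); split.
- by rewrite -cat_cons perm_cat2r.
- move: cyc; rewrite -(ce _ se) /= !rcons_path cat_path last_cat ls.
  by case/andP=> -> _; rewrite pq.
- move=> a b; rewrite -lk /linked steps_cons steps_cat ls !mem_rcons !in_cons !mem_cat.
  case/orP => /orP[/eqP[-> ->]|->]; rewrite ?orbT;
    by [constructor 1 | constructor 2 | constructor 3].
by move=> a b ab; rewrite /linked steps_cat mem_cat mem_rcons /= ls !in_cons ab !orbT.
Qed.

End CyclicSequences.

(** * Merging the orbits of a permutation into one cycle *)

Lemma traject_steps (V : eqType) (f : V -> V) x k i : i < k ->
  (iter i f x, f (iter i f x)) \in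
    zip (belast x (traject f (f x) k)) (traject f (f x) k).
Proof.
elim: k x i => [|k IH] x [|i] //= lt_ik; rewrite in_cons ?eqxx //.
by move: (IH (f x) i lt_ik); rewrite -iterSr /= => ->; rewrite orbT.
Qed.

(** An abstract form of the merging process: [adj] is to be disjointness of
    triangulations, [flip] the flip relation and [rho] the rotation. *)
Section OrbitMerging.
Variables (V : finType) (adj flip : rel V) (rho : {perm V}).
Hypotheses (adjC : symmetric adj)
  (adj_rho : forall x y, adj (rho x) (rho y) = adj x y)
  (adj_next : forall x, adj x (rho x)).
Hypotheses (flipC : symmetric flip)
  (flip_rho : forall x y, flip (rho x) (rho y) = flip x y)
  (flip_adj : forall x y, flip x y -> exists2 y', y' \in porbit rho y & adj x y').

Definition nbr_orbits x : {set {set V}} := [set porbit rho y | y in flip x]%SET.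
(** How many neighbouring orbits of [x] have been merged into [c] already; this
    bounds the number of edges [z -- rho z] of the orbit of [x] that have been
    spent. *)
Definition inside (c : seq V) x := #|[set Q in nbr_orbits x | Q \subset c]%SET|.
Definition unlinked (c : seq V) x : {set V} :=
  [set z in porbit rho x | ~~ linked c z (rho z)]%SET.

Hypothesis nbr_le : forall x, #|nbr_orbits x| <= #|porbit rho x|.

(** The invariant of the merging process. Its last clause is there for orbits of
    two elements, whose two steps [z -- rho z] and [rho z -- z] are one edge of
    the cycle, so that a single merger spends both. Such an orbit starts with
    both steps intact and one neighbour inside, which pays for this. *)
Definition merged c :=
  [/\ uniq c, path.cycle adj c, forall x, (rho x \in c) = (x \in c),
      {in c, forall x, #|unlinked c x| <= inside c x}
    & {in c, forall x, (2 < #|porbit rho x|) || (0 < inside c x)}].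

Lemma porbit_next x : porbit rho (rho x) = porbit rho x.
Proof. exact: (porbit_perm rho 1). Qed.

Lemma porbit_closed x v : (rho v \in porbit rho x) = (v \in porbit rho x).
Proof. by rewrite -!eq_porbit_mem porbit_next. Qed.

Lemma eq_porbit x v : v \in porbit rho x -> porbit rho v = porbit rho x.
Proof. by rewrite -eq_porbit_mem => /eqP. Qed.

Lemma nbr_orbits_porbit x z : z \in porbit rho x -> nbr_orbits z = nbr_orbits x.
Proof.
have step v : nbr_orbits (rho v) = nbr_orbits v.
  apply/setP => Q; apply/imsetP/imsetP => -[y Fy ->].
    exists (rho^-1%g y); last by rewrite -(porbit_next (rho^-1%g y)) permKV.
    by rewrite unfold_in -flip_rho permKV.
  by exists (rho y); rewrite ?porbit_next // unfold_in flip_rho.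
case/porbitP=> i ->; elim: i => [|i IH]; first by rewrite perm1.
by rewrite expgSr permM step.
Qed.

Lemma closed_porbit (c : seq V) x z :
  (forall x, (rho x \in c) = (x \in c)) ->
  z \in porbit rho x -> (z \in c) = (x \in c).
Proof.
move=> cl /porbitP[i ->]; elim: i => [|i IH]; first by rewrite perm1.
by rewrite expgSr permM cl.
Qed.

Lemma flip_porbit x y z : flip x y -> z \in porbit rho x ->
  exists2 y', y' \in porbit rho y & flip z y'.
Proof.
move=> Fxy /porbitP[i ->]; exists ((rho ^+ i)%g y); first exact: mem_porbit.
elim: i => [|i IH]; first by rewrite !perm1.
by rewrite expgSr !permM flip_rho.
Qed.

(** The orbit of [y], traversed from [rho y] to [y]: it uses all steps of the
    orbit but the one from [y] to [rho y]. *)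
Lemma orbit_path y : exists q,
  [/\ (rho y :: q) =i porbit rho y, uniq (rho y :: q),
      path adj (rho y) q, last (rho y) q = y
    & {in porbit rho y, forall a, a != y ->
        (a, rho a) \in zip (belast (rho y) q) q}].
Proof.
have := porbit_traject rho (rho y); have := uniq_traject_porbit rho (rho y).
have := iter_porbit rho (rho y); rewrite porbit_next.
case: #|_| => [_ _ /(_ (rho y))|k]; first by rewrite -porbit_next porbit_id.
rewrite iterS => /perm_inj ek Uk Ok; exists (traject rho (rho (rho y)) k).
split=> //.
- have path_orbit v j : path adj v (traject rho (rho v) j).
    by elim: j v => //= j IH v; rewrite adj_next IH.
  exact: path_orbit.
- by rewrite last_traject.
move=> a; rewrite Ok => /trajectP[i lt_i ->] ay.
apply: traject_steps; rewrite ltn_neqAle -ltnS lt_i andbT.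
by apply: contra ay => /eqP->; rewrite ek.
Qed.

(** The orbit that starts the process has no neighbour inside, whence the
    requirement of at least three elements. *)
Lemma merged_orbit x : 2 < #|porbit rho x| -> exists2 c, merged c & x \in c.
Proof.
move=> Ox; have [q [qO Uq pq lq cq]] := orbit_path x.
exists (rho x :: q); last by rewrite qO porbit_id.
split=> //.
- by rewrite /= rcons_path pq lq adj_next.
- by move=> v; rewrite !qO porbit_closed.
- move=> v; rewrite qO => vx; rewrite [unlinked _ _](_ : _ = finset.set0) ?cards0 //.
  apply/setP => a; rewrite !inE; have [av /=|//] := boolP (a \in _).
  have ax: a \in porbit rho x by rewrite -(eq_porbit vx).
  apply/negbF; rewrite /linked steps_cons !mem_rcons !inE lq.
  by have [->|/(cq _ ax)->] := eqVneq a x; rewrite ?eqxx ?orbT.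
move=> v; rewrite qO -eq_porbit_mem => /eqP->; by rewrite Ox.
Qed.

(** The orbit of [x] has a neighbour outside [c], so it has spent fewer edges
    than it has elements, and one edge [z -- rho z] is left. By rotation [z] also
    has a flip in the orbit of [y], so this edge can be replaced by a detour
    through that whole orbit. *)
Lemma merged_extend c x y : merged c -> x \in c -> y \notin c -> flip x y ->
  exists c', [/\ merged c', {subset c <= c'} & y \in c'].
Proof.
move=> [Uc cc cl cle c2] xc yc Fxy.
(* If all edges of the orbit were spent, all neighbouring orbits would be inside. *)
have [z zx lz] : exists2 z, z \in porbit rho x & linked c z (rho z).
  apply/exists_inP; apply: contraT; rewrite negb_exists_in => /forall_inP all_un.
  have le_in : #|porbit rho x| <= inside c x.
    apply: leq_trans (cle x xc); apply/subset_leq_card/fintype.subsetP => v vx.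
    by rewrite inE vx all_un.
  suff lt_in : inside c x < #|nbr_orbits x|.
    by have := leq_trans lt_in (leq_trans (nbr_le x) le_in); rewrite ltnn.
  apply: proper_card; apply/properP; split.
    by apply/fintype.subsetP => Q; rewrite inE => /andP[].
  exists (porbit rho y); first exact: imset_f.
  rewrite inE negb_and; apply/orP; right; apply/subsetPn.
  by exists y; rewrite ?porbit_id.
have [y1 y1y Fzy1] := flip_porbit Fxy zx.
have [y' y'y1 azy'] := flip_adj Fzy1.
have {y1 y1y Fzy1 y'y1} Oy : porbit rho y' = porbit rho y.
  by rewrite (eq_porbit y'y1) (eq_porbit y1y).
have [q [qO Uq pq lq cq]] := orbit_path y'.
have pq' : path adj (rho z) (rho y' :: q) by rewrite /= adj_rho azy'.
have lq' : adj (last (rho y') q) z by rewrite lq adjC.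
have [c' [pc cc' lc' nc']] := linked_detour adjC cc lz pq' lq'.
have mc' v : (v \in c') = (v \in c) || (v \in porbit rho y).
  by rewrite (perm_mem pc) mem_cat qO Oy.
have sub : {subset c <= c'} by move=> v vc; rewrite mc' vc.
have le_in v : inside c v <= inside c' v.
  apply/subset_leq_card/fintype.subsetP => Q; rewrite !inE => /andP[-> /=] /fintype.subsetP sQ.
  by apply/fintype.subsetP => u /sQ/sub.
have QN v : v \in porbit rho y -> v \notin c by move=> vy; rewrite (closed_porbit cl vy).
have zc : z \in c by rewrite (closed_porbit cl zx).
have inQ v : v \in porbit rho x -> inside c v < inside c' v.
  move=> vx; apply: proper_card; apply/properP; split.
    apply/fintype.subsetP => Q; rewrite !inE => /andP[-> /=] /fintype.subsetP sQ.
    by apply/fintype.subsetP => u /sQ/sub.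
  exists (porbit rho y); rewrite !inE (nbr_orbits_porbit vx).
    rewrite imset_f //=; apply/fintype.subsetP => u; rewrite mc' => ->; exact: orbT.
  rewrite negb_and; apply/orP; right; apply/subsetPn.
  by exists y; rewrite ?porbit_id.
have inY v : v \in porbit rho y -> 0 < inside c' v.
  move=> vy; apply/card_gt0P; exists (porbit rho x).
  rewrite inE (nbr_orbits_porbit vy); apply/andP; split.
    by apply: imset_f; rewrite -topredE /= flipC.
  by apply/fintype.subsetP => u ux; rewrite mc' (closed_porbit cl ux) xc.
exists c'; split=> //; last by rewrite mc' porbit_id orbT.
split=> //.
- rewrite (perm_uniq pc) cat_uniq Uc Uq andbT; apply/hasPn => v; rewrite qO Oy.
  exact: QN.
- by move=> v; rewrite !mc' cl porbit_closed.
- move=> v; rewrite mc'; have [vy _|vy] := boolP (v \in porbit rho y).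
    apply: leq_trans (inY v vy); rewrite -(cards1 y').
    apply/subset_leq_card/fintype.subsetP => a; rewrite !inE => /andP[av].
    have ay : a \in porbit rho y'.
      by rewrite Oy -(eq_porbit vy).
    by apply: contraR => /(cq _ ay)/nc' ->.
  rewrite orbF => vc; have [vx|vx] := boolP (v \in porbit rho x).
    apply: leq_trans (inQ v vx).
    have Ov : porbit rho v = porbit rho z.
      by rewrite (eq_porbit zx) (eq_porbit vx).
    (* Both steps of an orbit of two elements may be lost at once. *)
    have [rz|rz] := eqVneq (rho (rho z)) z.
      have O2 : porbit rho v \subset [set z; rho z]%SET.
        rewrite Ov; apply/fintype.subsetP => u /porbitP[i ->].
        elim: i => [|i]; first by rewrite perm1 !inE eqxx.
        by rewrite expgSr permM !inE => /orP[]/eqP->; rewrite ?rz eqxx ?orbT.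
      have := c2 v vc; rewrite ltnNge.
      have O2' : #|porbit rho v| <= 2.
        by rewrite (leq_trans (subset_leq_card O2)) // cards2; case: (_ != _).
      rewrite O2' /= => lt0; apply: leq_trans (lt0 : 1 < (inside c v).+1).
      apply: leq_trans O2'; apply/subset_leq_card/fintype.subsetP => a.
      by rewrite inE => /andP[].
    have := cle v vc; rewrite -ltnS; apply: leq_trans; apply: leq_trans (_ : #|z |: unlinked c v| <= _).
      apply/subset_leq_card/fintype.subsetP => a; rewrite !inE => /andP[av].
      rewrite av /=; have [//|az /=] := eqVneq a z; apply: contra.
      by move=> /lc'[//|[/eqP]|[-> /eqP]]; rewrite ?(negbTE az) ?(negbTE rz).
    by rewrite cardsU1 -add1n leq_add2r leq_b1.
  apply: leq_trans (leq_trans (cle v vc) (le_in v)).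
  apply/subset_leq_card/fintype.subsetP => a; rewrite !inE => /andP[av].
  rewrite av /=; apply: contra => /lc'[//|[az _]|[az _]]; case/negP: vx.
    by rewrite porbit_sym -(eq_porbit av) az (eq_porbit zx) porbit_id.
  by rewrite porbit_sym -(eq_porbit av) az porbit_next (eq_porbit zx) porbit_id.
move=> v; rewrite mc' => /orP[vc|/inY->]; last by rewrite orbT.
by case/orP: (c2 v vc) => [->//|lt0]; rewrite (leq_trans lt0 (le_in v)) orbT.
Qed.

Theorem hamiltonian_orbit_merging x0 :
  2 < #|porbit rho x0| -> (forall x, connect flip x0 x) ->
  exists c, [/\ uniq c, path.cycle adj c & forall x, x \in c].
Proof.
move=> O3 conn; have [c gc cx0] := merged_orbit O3.
elim: {c}_.+1 {-2}c (ltnSn (#|V| - size c)) gc cx0 => // k IH c szc gc cx0.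
have [/forallP all_c|] := boolP [forall x, x \in c].
  by exists c; case: gc.
rewrite negb_forall => /existsP[v vc].
have [x [y [xc yc Fxy]]] : exists x y, [/\ x \in c, y \notin c & flip x y].
  have /connectP[p pp lv] := conn v; rewrite {}lv in vc.
  elim: p x0 cx0 pp vc {conn O3 IH} => [|y p IHp] x xc /=; first by rewrite xc.
  case/andP=> Fxy pp lp; have [yc|yc] := boolP (y \in c); last by exists x, y.
  exact: IHp lp.
have [c' [gc' sub yc']] := merged_extend gc xc yc Fxy.
apply: (IH c') => //; last exact: sub.
have [Uc' _ _ _ _] := gc'; have [Uc _ _ _ _] := gc.
have lt_c : size c < size c'.
  rewrite -(card_uniqP Uc) -(card_uniqP Uc'); apply: proper_card.
  by apply/properP; split; [apply/fintype.subsetP | exists y].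
have le_c : size c' <= #|V| by rewrite -(card_uniqP Uc') max_card.
by move: szc lt_c le_c; move: #|V| => N; lia.
Qed.

End OrbitMerging.

(** * Chords of a polygon and their rotation *)

Section Chords.
Variable n : nat.
Implicit Types (i j k l : 'I_n) (D E F : {set 'I_n}) (T : {set {set 'I_n}}).

Definition interleave (i j k l : nat) :=
  [&& i < k, k < j & j < l] || [&& k < i, i < l & l < j].

Definition nonadjacent (i j : nat) := (i.+1 < j) && ~~ ((i == 0) && (j == n.-1)).

Lemma chord_inj i j k l : i < j -> k < l ->
  [set i; j]%SET = [set k; l]%SET -> i = k /\ j = l.
Proof.
move=> ij kl e.
have := set21 i j; rewrite e !inE; have := set22 i j; rewrite e !inE.
have := set21 k l; rewrite -e !inE; have := set22 k l; rewrite -e !inE -!val_eqE /=.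
move=> *; split; apply: val_inj => /=; lia.
Qed.

Lemma diagonalP D :
  reflect (exists i j, nonadjacent i j /\ D = [set i; j]%SET) (D \in diagonals n).
Proof.
have md (a : nat) : a < n -> a.+1 %% n = if a.+1 == n then 0 else a.+1.
  by case: eqP => [->|ne lt]; rewrite ?modnn // modn_small //; lia.
rewrite inE; apply: (iffP existsP) => [[i /existsP[j]]|[i [j [ij ->]]]].
  rewrite !(modn_small (ltn_ord _)) !md // => /and4P[/eqP-> nij n1 n2].
  have := ltn_ord i; have := ltn_ord j.
  have [lt|lt|/val_inj e] := ltngtP i j; last by rewrite e eqxx in nij.
    by exists i, j; rewrite /nonadjacent; split=> //; move: n1 n2; case: ifP; case: ifP; lia.
  exists j, i; rewrite finset.setUC /nonadjacent; split=> //.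
  by move: n1 n2; case: ifP; case: ifP; lia.
exists i; apply/existsP; exists j; rewrite eqxx !(modn_small (ltn_ord _)) !md //=.
have := ltn_ord i; have := ltn_ord j; rewrite /nonadjacent in ij.
by case: ifP; case: ifP; lia.
Qed.

Lemma alternate_chord i j k l : i < j -> k < l ->
  alternate [set i; j]%SET [set k; l]%SET = [&& i < k, k < j & j < l].
Proof.
move=> ij kl; apply/idP/idP.
  move=> /existsP[a /existsP[b /existsP[c /existsP[d /and5P[ab bc cd]]]]].
  move=> /eqP/chord_inj[//|/=|-> ->] ; first lia.
  by move=> /eqP/chord_inj[//||-> ->]; [lia | rewrite ab bc].
case/and3P => ik kj jl; apply/existsP; exists i; apply/existsP; exists k.
by apply/existsP; exists j; apply/existsP; exists l; rewrite ik kj jl !eqxx.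
Qed.

Lemma crossing_chord i j k l : i < j -> k < l ->
  crossing [set i; j]%SET [set k; l]%SET = interleave i j k l.
Proof. by move=> ij kl; rewrite /crossing !alternate_chord. Qed.

Lemma crossingC D E : crossing D E = crossing E D.
Proof. exact: orbC. Qed.

Definition turnD D : {set 'I_n} := [set ordS x | x in D]%SET.

Lemma turnD_inj : injective turnD.
Proof. exact/imset_inj/ordS_inj. Qed.

(** The rotation is followed on ordered pairs of endpoints; the order is swapped
    when the larger endpoint wraps around to [0]. *)
Lemma turnD_chord i j : i < j -> exists i' j',
  [/\ turnD [set i; j]%SET = [set i'; j']%SET, i' < j' &
    [/\ j.+1 = n, i' = 0 :> nat & j' = i.+1 :> nat] \/
    [/\ j.+1 < n, i' = i.+1 :> nat & j' = j.+1 :> nat]].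
Proof.
move=> ij; have := ltn_ord j; rewrite leq_eqVlt => /orP[/eqP jn|jn].
  exists (ordS j), (ordS i); rewrite /turnD imsetU !imset_set1 finset.setUC /=.
  rewrite jn modnn modn_small; last by lia.
  by split=> //; left.
exists (ordS i), (ordS j); rewrite /turnD imsetU !imset_set1 /=.
rewrite !modn_small; try by lia.
by split=> //; right.
Qed.

Lemma turnD_diagonal D : D \in diagonals n -> turnD D \in diagonals n.
Proof.
move=> /diagonalP[i [j [ij ->]]]; have ltij : i < j by move: ij; rewrite /nonadjacent; lia.
have [i' [j' [-> lt H]]] := turnD_chord ltij; apply/diagonalP; exists i', j'.
split=> //; have := ltn_ord j'; move: ij; rewrite /nonadjacent.
by case: H => [[]|[]]; lia.
Qed.

Lemma diagonal_lt i j : nonadjacent i j -> i < j. Proof. rewrite /nonadjacent; lia. Qed.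

Lemma crossing_turnD D E : D \in diagonals n -> E \in diagonals n ->
  crossing (turnD D) (turnD E) = crossing D E.
Proof.
move=> /diagonalP[i [j [/diagonal_lt ij ->]]] /diagonalP[k [l [/diagonal_lt kl ->]]].
have [i' [j' [-> lt H]]] := turnD_chord ij.
have [k' [l' [-> lt' H']]] := turnD_chord kl.
rewrite !crossing_chord // /interleave; have := ltn_ord j; have := ltn_ord l.
by case: H => [[]|[]]; case: H' => [[]|[]]; lia.
Qed.

(** The endpoints [i < i + 1 < j < j + 1] alternate, since [i + 1] differs from
    [j] and [j + 1] from [i]. *)
Lemma crossing_turnD_self D : D \in diagonals n -> crossing D (turnD D).
Proof.
move=> /diagonalP[i [j [ij ->]]]; have ltij := diagonal_lt ij.
have [i' [j' [-> lt H]]] := turnD_chord ltij.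
rewrite crossing_chord // /interleave; have := ltn_ord j; move: ij; rewrite /nonadjacent.
by case: H => [[]|[]]; lia.
Qed.

Lemma crossing_irrefl D : D \in diagonals n -> crossing D D = false.
Proof.
by move=> /diagonalP[i [j [/diagonal_lt ij ->]]]; rewrite crossing_chord // /interleave; lia.
Qed.

(** For [n = 4] both diagonals are fixed by a half turn. *)
Lemma turnD2_neq D : 5 <= n -> D \in diagonals n -> turnD (turnD D) != D.
Proof.
move=> n5 /diagonalP[i [j [ij ->]]]; have ltij := diagonal_lt ij.
have [i' [j' [-> lt H]]] := turnD_chord ltij.
have [k [l [-> lt' H']]] := turnD_chord lt.
apply/eqP => /chord_inj[//|//|/(congr1 val) /= e /(congr1 val) /= e'].
have := ltn_ord j; move: ij; rewrite /nonadjacent.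
by case: H => [[]|[]]; case: H' => [[]|[]]; lia.
Qed.

Definition noncrossing (X : {set {set 'I_n}}) :=
  [forall D in X, forall E in X, ~~ crossing D E].

Lemma noncrossingP (X : {set {set 'I_n}}) :
  reflect (forall D E, D \in X -> E \in X -> ~~ crossing D E) (noncrossing X).
Proof.
apply: (iffP forall_inP) => [H D E DX EX|H D DX].
  by have /forall_inP := H D DX; apply.
by apply/forall_inP => E EX; exact: H.
Qed.

Lemma triangulationP T : reflect
  [/\ T \subset diagonals n, #|T| = n - 3 & noncrossing T] (is_triangulation T).
Proof.
by apply: (iffP and3P) => -[? c ?]; split=> //; apply/eqP.
Qed.

Definition turnT T : {set {set 'I_n}} := [set turnD D | D in T]%SET.

Lemma turnT_inj : injective turnT.
Proof. exact/imset_inj/turnD_inj. Qed.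

Lemma turnT_triangulation T : is_triangulation T -> is_triangulation (turnT T).
Proof.
move=> /triangulationP[/fintype.subsetP Td cT /noncrossingP Tn]; apply/triangulationP; split.
- by apply/fintype.subsetP => _ /imsetP[D DT ->]; exact/turnD_diagonal/Td.
- by rewrite card_imset //; exact: turnD_inj.
apply/noncrossingP => _ _ /imsetP[D DT ->] /imsetP[E ET ->].
by rewrite crossing_turnD ?Tn ?Td.
Qed.

(** A common diagonal would be the image of another diagonal of [T], which it
    crosses. *)
Lemma disjoint_turnT T : is_triangulation T -> [disjoint T & turnT T].
Proof.
move=> /triangulationP[/fintype.subsetP Td _ /noncrossingP Tn].
rewrite disjoint_sym; apply/pred0P => D /=; apply/negP => /andP[/imsetP[E ET ->] DT].
by have := Tn _ _ ET DT; rewrite crossing_turnD_self // Td.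
Qed.

(** Triangulations of one polygon have the same size, so one diagonal of [T] is
    exchanged for one of [T']; these are the diagonals of the quadrilateral left
    by the others. *)
Definition flip T T' := #|T :\: T'|%SET == 1.

Lemma flipC T T' : is_triangulation T -> is_triangulation T' -> flip T T' = flip T' T.
Proof.
move=> /triangulationP[_ c _] /triangulationP[_ c' _].
by rewrite /flip !cardsD c c' finset.setIC.
Qed.

(** Let [x] be the diagonal of [T] exchanged for [y]. If [T] meets the image of
    [T'], the common diagonal comes from a diagonal of [T'] that crosses it. No
    two diagonals of the same triangulation cross, so the former is [x] and the
    latter [y]: [x] is the image of [y]. If [T'] also meets the image of [T],
    then [y] is the image of [x], and [x] is fixed by two rotation steps. *)
Lemma flip_disjoint T T' : 5 <= n -> is_triangulation T -> is_triangulation T' ->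
  flip T T' -> [disjoint T & turnT T'] || [disjoint T' & turnT T].
Proof.
move=> n5 tT tT'; have := flipC tT tT'; rewrite /flip => -> F'.
have F : #|T :\: T'|%SET == 1 by rewrite -[_ == _]/(flip T T') flipC.
have key (S S' : {set {set 'I_n}}) : is_triangulation S -> is_triangulation S' ->
    ~~ [disjoint S & turnT S'] ->
    exists E, [/\ E \in (S' :\: S)%SET & turnD E \in (S :\: S')%SET].
  move=> /triangulationP[/fintype.subsetP Sd _ /noncrossingP Sn].
  move=> /triangulationP[/fintype.subsetP Sd' _ /noncrossingP Sn'].
  move=> /pred0Pn[D /= /andP[DS /imsetP[E ES' eD]]]; exists E; rewrite -eD !inE DS ES' !andbT.
  have cED : crossing E D by rewrite eD crossing_turnD_self // Sd'.
  split; first by apply: contraL cED => ES; exact: Sn.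
  by apply: contraL cED => DS'; exact: Sn'.
have [//|/(key _ _ tT tT')[E [E1 E2]]] := boolP [disjoint T & turnT T'].
apply: contraT => /(key _ _ tT' tT)[G [G1 G2]].
have [x ex] := cards1P F; have [y ey] := cards1P F'.
move: E1 E2 G1 G2; rewrite ex ey !inE => /eqP-> /eqP rx /eqP eG.
rewrite eG -rx => /eqP ry; have : y \in diagonals n.
  have : y \in (T' :\: T)%SET by rewrite ey inE.
  by case/setDP=> yT' _; case/triangulationP: tT' => /fintype.subsetP/(_ y yT').
by move/(turnD2_neq n5); rewrite ry eqxx.
Qed.

End Chords.

(** * Size and decomposition of noncrossing families of chords *)

Section Families.
Variable n : nat.
Implicit Types (x y : 'I_n * 'I_n) (X : {set 'I_n * 'I_n}) (a k m : nat).

(** Chords are represented here by their ordered pairs of endpoints; the integer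
    coordinates get a name to be atoms for linear arithmetic. *)
Definition src x : nat := x.1.
Definition tgt x : nat := x.2.

(** Noncrossing chords of the polygon with vertices [a], ..., [a + m + 1], which
    has [m + 2] sides. The side from [a] to [a + m + 1] counts as a chord: with
    this convention the chords of a triangulation correspond to its [m]
    triangles, and the recursion below has no exceptional case. *)
Definition chord_family a m X :=
  [forall x in X, [&& a <= src x, (src x).+1 < tgt x & tgt x <= a + m.+1]] &&
  [forall x in X, forall y in X, ~~ interleave (src x) (tgt x) (src y) (tgt y)].

Lemma chord_familyP a m X : reflect
  ((forall x, x \in X -> [/\ a <= src x, (src x).+1 < tgt x & tgt x <= a + m.+1]) /\
   (forall x y, x \in X -> y \in X -> ~~ interleave (src x) (tgt x) (src y) (tgt y)))
  (chord_family a m X).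
Proof.
apply: (iffP andP) => -[rX nX]; split.
- by move=> x /(forall_inP rX)/and3P.
- by move=> x y xX yX; apply: (forall_inP (forall_inP nX x xX)).
- by apply/forall_inP => x /rX[-> -> ->].
by apply/forall_inP => x xX; apply/forall_inP => y yX; exact: nX.
Qed.

Lemma chord_family_sub a m a' m' X X' : chord_family a m X -> X' \subset X ->
  (forall x, x \in X' -> a' <= src x /\ tgt x <= a' + m'.+1) -> chord_family a' m' X'.
Proof.
move=> /chord_familyP[rX nX] /fintype.subsetP s rX'; apply/chord_familyP; split=> [x xX|x y /s xX /s yX].
  by have [? ?] := rX' x xX; have [] := rX x (s x xX).
exact: nX.
Qed.

Definition top_side a m X := [set x in X | (src x == a) && (tgt x == a + m.+1)]%SET.
Definition left_part k X := [set x in X | tgt x <= k]%SET.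
Definition right_part k X := [set x in X | k <= src x]%SET.

Lemma card_top_side a m X : #|top_side a m X| <= 1.
Proof.
apply/card_le1_eqP => x y; rewrite !inE => /and3P[_ /eqP x1 /eqP x2] /and3P[_ /eqP y1 /eqP y2].
by rewrite [y]surjective_pairing [x]surjective_pairing; congr pair; apply: val_inj;
  rewrite -?[LHS]/(src _) -?[RHS]/(src _) -?[LHS]/(tgt _) -?[RHS]/(tgt _) ?x1 ?x2.
Qed.

(** The vertex [k] is the apex of the triangle on the side from [a] to
    [a + m + 2]: the largest [k] other than the end of that side which is joined
    to [a] by a chord of [X] or by a side. A chord passing over [k] would cross
    the chord from [a] to [k], or start at [a] and contradict the maximality
    of [k]. *)
Lemma chord_family_split a m X : chord_family a m.+1 X -> exists k,
  [/\ a < k, k <= a + m.+1, X \subset (top_side a m.+1 X :|: (left_part k X :|: right_part k X))%SET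
    & k = a.+1 \/ exists2 x, x \in X & src x = a /\ tgt x = k].
Proof.
move=> /chord_familyP[rX nX].
pose P k := (k <= a + m.+1) && ((k == a.+1) ||
  [exists x in X, (src x == a) && (tgt x == k)]).
have exP : exists k, P k by exists a.+1; rewrite /P eqxx; lia.
have [k Pk kmax] : exists2 k, P k & forall j, P j -> j <= k.
  case: (@ex_maxnP P (a + m.+1) exP) => [j /andP[]//|j ? ?]; by exists j.
have [le_k Hk] := andP Pk.
have Hk' : k = a.+1 \/ exists2 x, x \in X & src x = a /\ tgt x = k.
  case/orP: Hk => [/eqP->|/exists_inP[x xX /andP[/eqP x1 /eqP x2]]]; first by left.
  by right; exists x.
exists k; split=> //.
  by case: Hk' => [->//|[x xX [x1 x2]]]; have [_ + _] := rX x xX; rewrite x1 x2; lia.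
apply/fintype.subsetP => x xX; have [ax x12 xb] := rX x xX; rewrite !inE xX /=.
have [//|xk] := leqP (tgt x) k; first by rewrite orbT.
have [//|kx] := leqP k (src x); first by rewrite !orbT.
have [x1a|x1a] := eqVneq (src x) a.
  have [x2b|x2b] := eqVneq (tgt x) (a + m.+2) => //=.
  have : P (tgt x).
    apply/andP; split; first by lia.
    by apply/orP; right; apply/exists_inP; exists x; rewrite // x1a !eqxx.
  by move/kmax; lia.
case: Hk' => [ek|[y yX [y1 y2]]]; first by lia.
by have := nX y x yX xX; rewrite /interleave; lia.
Qed.

Lemma chord_family_left a m k X :
  chord_family a m X -> a < k -> chord_family a (k - a.+1) (left_part k X).
Proof.
move=> fX ak; apply: (chord_family_sub fX); first by apply/fintype.subsetP => x; rewrite inE => /andP[].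
case/chord_familyP: fX => rX _ x; rewrite inE => /andP[/rX[? ? ?] ?]; lia.
Qed.

Lemma chord_family_right a m k X :
  chord_family a m X -> k < a + m.+1 -> chord_family k (a + m - k) (right_part k X).
Proof.
move=> fX ak; apply: (chord_family_sub fX); first by apply/fintype.subsetP => x; rewrite inE => /andP[].
case/chord_familyP: fX => rX _ x; rewrite inE => /andP[/rX[? ? ?] ?]; lia.
Qed.

(** Besides the top side, [X] splits into families of the polygons on both sides
    of the apex, whose parameters add up to [m - 1]. *)
Lemma chord_family_card_le a m X : chord_family a m X -> #|X| <= m.
Proof.
elim/ltn_ind: m a X => -[|m] IH a X fX.
  case/chord_familyP: fX => rX _; rewrite leqn0 cards_eq0; apply/eqP/setP => x.
  by rewrite inE; apply/negP => /rX[]; lia.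
have [k [ak kb sX _]] := chord_family_split fX.
have lt_k : k < a + m.+2 by lia.
have lel : #|left_part k X| <= k - a.+1 by apply: IH (chord_family_left fX ak); lia.
have ler : #|right_part k X| <= a + m.+1 - k by apply: IH (chord_family_right fX lt_k); lia.
have := subset_leq_card sX; have := card_top_side a m.+1 X.
have [+ _] := leq_card_setU (top_side a m.+1 X) (left_part k X :|: right_part k X).
have [+ _] := leq_card_setU (left_part k X) (right_part k X).
move: lel ler; move: #|_| #|_| #|_| #|_| #|_| #|_| => *; lia.
Qed.
End Families.

(** * Uniqueness of flips *)

Section DiagonalSets.
Variable n : nat.
Hypothesis n_gt2 : 2 < n.
Implicit Types (x y : 'I_n * 'I_n) (D E F : {set 'I_n}) (T Y : {set {set 'I_n}})
  (X : {set 'I_n * 'I_n}).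

Definition chord x : {set 'I_n} := [set x.1; x.2]%SET.

Lemma chord_pair_inj x y : src x < tgt x -> src y < tgt y -> chord x = chord y -> x = y.
Proof.
move=> lx ly /(chord_inj lx ly)[e1 e2].
by rewrite [x]surjective_pairing [y]surjective_pairing e1 e2.
Qed.

Lemma diagonal_chord D :
  reflect (exists2 x, nonadjacent n (src x) (tgt x) & D = chord x) (D \in diagonals n).
Proof.
apply: (iffP (diagonalP D)) => [[i [j [ij ->]]]|[x dx ->]]; first by exists (i, j).
by exists x.1, x.2.
Qed.

Lemma chord_diagonal x : src x < tgt x -> (chord x \in diagonals n) = nonadjacent n (src x) (tgt x).
Proof.
move=> lx; apply/idP/idP => [/diagonal_chord[y dy /chord_pair_inj->//]|dx].
  exact: diagonal_lt dy.
by apply/diagonal_chord; exists x.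
Qed.

Lemma tgt_lt x : tgt x < n. Proof. exact: ltn_ord. Qed.

(** The side of the polygon from [0] to [n - 1]. Adding it turns a noncrossing
    set of diagonals into a family of the whole polygon. *)
Definition long_side : 'I_n * 'I_n :=
  (Ordinal (ltn_trans (isT : 0 < 2) n_gt2), Ordinal (etrans (ltn_predL n) (ltn_trans (isT : 0 < 2) n_gt2))).

Definition pairs_of Y := [set x | (src x < tgt x) && (chord x \in Y)]%SET.

Lemma pairs_ofE Y : Y \subset diagonals n -> chord @: pairs_of Y = Y.
Proof.
move=> /fintype.subsetP Yd; apply/setP => D; apply/imsetP/idP => [[x]|DY].
  by rewrite inE => /andP[_ ?] ->.
have /diagonal_chord[x dx eD] := Yd D DY; exists x => //.
by rewrite inE -eD DY (diagonal_lt dx).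
Qed.

Lemma card_pairs_of Y : Y \subset diagonals n -> #|pairs_of Y| = #|Y|.
Proof.
move=> Yd; rewrite -[in RHS](pairs_ofE Yd) card_in_imset // => x y.
by rewrite !inE => /andP[? _] /andP[? _]; exact: chord_pair_inj.
Qed.

Lemma nonadjacent_pairs_of Y x : Y \subset diagonals n -> x \in pairs_of Y -> nonadjacent n (src x) (tgt x).
Proof.
by move=> /fintype.subsetP Yd; rewrite inE => /andP[lx /Yd]; rewrite chord_diagonal.
Qed.

Lemma chord_family_pairs_of Y : Y \subset diagonals n -> noncrossing Y ->
  chord_family 0 (n - 2) (long_side |: pairs_of Y).
Proof.
move=> Yd /noncrossingP Yn; apply/chord_familyP; split=> [x|x y].
  rewrite in_setU1 => /predU1P[->|/(nonadjacent_pairs_of Yd)]; rewrite /src /tgt /=.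
    by split=> //; lia.
  by rewrite /nonadjacent; have := tgt_lt x; rewrite /tgt; split=> //; lia.
have lt y' : y' \in pairs_of Y -> src y' < tgt y' /\ chord y' \in Y.
  by rewrite inE => /andP[].
have := tgt_lt x; have := tgt_lt y.
rewrite !in_setU1 => yn xn /predU1P[->|/lt[xl xY]] /predU1P[->|/lt[yl yY]];
  try by rewrite /interleave /src /tgt /=; rewrite /src /tgt in xn yn; lia.
by rewrite -crossing_chord // Yn.
Qed.

Lemma long_side_pairs Y : Y \subset diagonals n -> long_side \notin pairs_of Y.
Proof.
by move=> Yd; apply/negP => /(nonadjacent_pairs_of Yd); rewrite /nonadjacent /src /tgt /=; lia.
Qed.

Lemma card_noncrossing Y : Y \subset diagonals n -> noncrossing Y -> #|Y| <= n - 3.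
Proof.
move=> Yd Yn; have := chord_family_card_le (chord_family_pairs_of Yd Yn).
by rewrite cardsU1 long_side_pairs // card_pairs_of //; lia.
Qed.

Lemma noncrossing_add Y D : D \in diagonals n -> noncrossing Y ->
  (forall E, E \in Y -> ~~ crossing D E) -> noncrossing (D |: Y).
Proof.
move=> Dd /noncrossingP Yn DY; apply/noncrossingP => E F.
rewrite !in_setU1 => /predU1P[->|EY] /predU1P[->|FY].
- by rewrite crossing_irrefl.
- exact: DY.
- by rewrite crossingC; exact: DY.
exact: Yn.
Qed.

Lemma noncrossing_sub Y Y' : Y' \subset Y -> noncrossing Y -> noncrossing Y'.
Proof.
move=> /fintype.subsetP s /noncrossingP Yn; apply/noncrossingP => D E /s DY /s EY; exact: Yn.
Qed.

Lemma interleave_hexagon (i1 i2 i3 j1 j2 j3 k l : nat) :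
    i1 < i2 -> i2 < i3 -> i3 < j1 -> j1 < j2 -> j2 < j3 -> k < l ->
    ~~ interleave i1 j1 k l -> ~~ interleave i2 j2 k l -> ~~ interleave i3 j3 k l ->
  ~~ interleave i1 i3 k l.
Proof. by rewrite /interleave; lia. Qed.

Lemma interleaveC (i j k l : nat) : interleave i j k l = interleave k l i j.
Proof. by rewrite /interleave orbC. Qed.

Lemma interleave_neq (i j k l : nat) : interleave i j k l -> i <> k.
Proof. by rewrite /interleave; lia. Qed.

Lemma interleave_lt (i j k l : nat) : i < k -> interleave i j k l -> [/\ i < k, k < j & j < l].
Proof. by rewrite /interleave => ik H; split; lia. Qed.

(** The endpoints form a hexagon [i1 < i2 < i3 < j1 < j2 < j3] with its long
    diagonals. The short diagonal from [i1] to [i3] meets no chord of [Y]: such a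
    chord would start at a vertex between [i1] and [i3] and, crossing none of the
    three long diagonals, would have nowhere to end. Hence [Y] can be extended by
    two diagonals, which is one too many. *)
Lemma three_crossing_exchanges Y (i1 i2 i3 j1 j2 j3 : 'I_n) :
    Y \subset diagonals n -> noncrossing Y -> #|Y| = n - 4 -> 3 < n ->
    [/\ i1 < i2, i2 < i3, i3 < j1, j1 < j2 & j2 < j3] ->
    (forall D, D \in [:: [set i1; j1]; [set i2; j2]; [set i3; j3]]%SET ->
       D \notin Y /\ forall E, E \in Y -> ~~ crossing D E) ->
  False.
Proof.
move=> Yd Yn cY n3 [i12 i23 i3j1 j12 j23] H; have j3n := ltn_ord j3.
have [l1 l2 l3 l13] : [/\ i1 < j1, i2 < j2, i3 < j3 & i1 < i3] by split; lia.
have [n1 c1] := H [set i1; j1]%SET (mem_head _ _).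
have [_ c2] : [set i2; j2]%SET \notin Y /\ forall E, E \in Y -> ~~ crossing [set i2; j2]%SET E.
  by apply: H; rewrite !inE eqxx orbT.
have [_ c3] : [set i3; j3]%SET \notin Y /\ forall E, E \in Y -> ~~ crossing [set i3; j3]%SET E.
  by apply: H; rewrite !inE eqxx !orbT.
have d1 : [set i1; j1]%SET \in diagonals n.
  by apply/diagonalP; exists i1, j1; split=> //; clear -i12 i23 i3j1 j12 j23 j3n; rewrite /nonadjacent; lia.
have dG : [set i1; i3]%SET \in diagonals n.
  by apply/diagonalP; exists i1, i3; split=> //; clear -i12 i23 i3j1 j12 j23 j3n; rewrite /nonadjacent; lia.
have cG E : E \in Y -> ~~ crossing [set i1; i3]%SET E.
  move=> EY; have /diagonalP[k [l [/diagonal_lt kl eE]]] := fintype.subsetP Yd E EY.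
  have := c1 E EY; have := c2 E EY; have := c3 E EY.
  rewrite eE !crossing_chord // => h3 h2 h1; exact: (interleave_hexagon i12 i23 i3j1 j12 j23 kl h1 h2 h3).
have nG : [set i1; i3]%SET \notin [set i1; j1]%SET |: Y.
  rewrite in_setU1 negb_or; apply/andP; split.
    by apply/eqP => /(chord_inj l13 l1)[_ e]; rewrite e ltnn in i3j1.
  apply/negP => /c2; rewrite crossing_chord //.
  by clear -i12 i23 i3j1 j12; rewrite /interleave; lia.
have nc1 : noncrossing ([set i1; j1]%SET |: Y) by exact: (noncrossing_add d1 Yn c1).
have := @card_noncrossing ([set i1; i3]%SET |: ([set i1; j1]%SET |: Y)).
rewrite !cardsU1 nG n1 cY !finset.subUset !finset.sub1set dG d1 Yd => /(_ isT) le.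
have : 1 + (1 + (n - 4)) <= n - 3; last by clear -n3; lia.
apply: le; apply: (noncrossing_add dG nc1) => E.
rewrite in_setU1 => /predU1P[->|]; last exact: cG.
by rewrite crossing_chord //; clear -i12 i23 i3j1; rewrite /interleave; lia.
Qed.

Lemma triangulation_maximal T D : is_triangulation T -> D \in diagonals n -> D \notin T ->
  exists2 E, E \in T & crossing D E.
Proof.
move=> /triangulationP[Td cT Tn] Dd DT; apply/exists_inP; apply: contraT.
rewrite negb_exists_in => /forall_inP nc.
have := @card_noncrossing (D |: T); rewrite cardsU1 DT cT finset.subUset finset.sub1set Dd Td.
by move=> /(_ isT (noncrossing_add Dd Tn nc)); lia.
Qed.

(** Let [Y] be [T] without [D]. The triangulations [T], [T1] and [T2] each extend
    [Y] by one diagonal. Were they distinct, these three diagonals would cross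
    each other pairwise, by the maximality of triangulations, so that
    [three_crossing_exchanges] applies. *)
Lemma flip_unique T T1 T2 D : is_triangulation T -> is_triangulation T1 ->
  is_triangulation T2 -> (T :\: T1 = [set D])%SET -> (T :\: T2 = [set D])%SET -> T1 = T2.
Proof.
move=> tT tT1 tT2 e1 e2.
pose Y := (T :\ D)%SET; have YT : Y \subset T by exact: subsetDl.
have [Td cT Tn] := triangulationP _ tT.
have DT : D \in T by have /setDP[] : D \in (T :\: T1)%SET by rewrite e1 inE.
have cY : #|Y|.+1 = n - 3 by have := cardsD1 D T; rewrite DT cT add1n => ->.
have Ysub S : (T :\: S = [set D])%SET -> Y \subset S.
  move=> eS; apply/fintype.subsetP => E; rewrite !inE => /andP[ED ET]; apply: contraT => ES.
  have : E \in (T :\: S)%SET by rewrite !inE ES.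
  by rewrite eS inE (negbTE ED).
clearbody Y; have ext S : is_triangulation S -> Y \subset S -> exists2 E, E \notin Y & S = E |: Y.
  move=> /triangulationP[Sd cS _] sYS.
  have /cards1P[E eE] : #|S :\: Y|%SET == 1.
    by apply/eqP; rewrite cardsD (finset.setIidPr sYS) cS -cY subSnn.
  have /setDP[ES EY] : E \in (S :\: Y)%SET by rewrite eE inE.
  exists E => //; apply/setP => F; rewrite in_setU1.
  have := congr1 (fun A : {set _} => F \in A) eE; rewrite !inE.
  case: (boolP (F \in Y)) => [FY _|_ /= <-]; last by rewrite orbF.
  by rewrite orbT (fintype.subsetP sYS).
have [D1 D1Y eT1] := ext _ tT1 (Ysub _ e1).
have [D2 D2Y eT2] := ext _ tT2 (Ysub _ e2).
have [D0 D0Y eT] := ext _ tT YT.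
have cross E F : E \notin Y -> F \notin Y -> is_triangulation (E |: Y) ->
    is_triangulation (F |: Y) -> E != F -> crossing E F.
  move=> EY FY tE /triangulationP[Fd _ /noncrossingP Fn] EF.
  have [||G] := triangulation_maximal (D := F) tE.
  - by apply: (fintype.subsetP Fd); rewrite in_setU1 eqxx.
  - by rewrite in_setU1 negb_or eq_sym EF.
  rewrite in_setU1 => /predU1P[->|GY]; first by rewrite crossingC.
  by rewrite (negbTE (Fn _ _ _ _)) // in_setU1 ?eqxx ?GY ?orbT.
have [->|ne] := eqVneq T1 T2; first by [].
have ne' S : (T :\: S = [set D])%SET -> T != S.
  by move=> eS; apply/eqP => TS; move: DT; have := finset.in_set0 D; rewrite -(finset.setDv S) -{1}TS eS inE eqxx.
have neD (E F : {set 'I_n}) : E |: Y != F |: Y -> E != F by apply: contra => /eqP->.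
have [tD0 tD1 tD2] : [/\ is_triangulation (D0 |: Y), is_triangulation (D1 |: Y) &
   is_triangulation (D2 |: Y)] by rewrite -eT -eT1 -eT2.
have c01 : crossing D0 D1 by apply: cross => //; apply: neD; rewrite -eT -eT1 ne'.
have c02 : crossing D0 D2 by apply: cross => //; apply: neD; rewrite -eT -eT2 ne'.
have c12 : crossing D1 D2 by apply: cross => //; apply: neD; rewrite -eT1 -eT2.
have Yd : Y \subset diagonals n by exact: fintype.subset_trans Td.
have Yn : noncrossing Y by exact: noncrossing_sub Tn.
have free E : is_triangulation (E |: Y) -> forall F, F \in Y -> ~~ crossing E F.
  move=> /triangulationP[_ _ /noncrossingP En] F FY.
  by apply: En; rewrite in_setU1 ?eqxx ?FY ?orbT.
have diag E : is_triangulation (E |: Y) -> E \in diagonals n.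
  by move=> /triangulationP[/fintype.subsetP Ed _ _]; apply: Ed; rewrite in_setU1 eqxx.
have := diag _ tD0; have := diag _ tD1; have := diag _ tD2.
move=> /diagonalP[i2 [j2 [/diagonal_lt l2 f2]]] /diagonalP[i1 [j1 [/diagonal_lt l1 f1]]].
move=> /diagonalP[i0 [j0 [/diagonal_lt l0 f0]]].
move: c01 c02 c12; rewrite f0 f1 f2 !crossing_chord // => c01 c02 c12.
have [n3 cY4] : 3 < n /\ #|Y| = n - 4 by clear -cY; lia.
have H E : E \in [:: D0; D1; D2] -> E \notin Y /\ forall F, F \in Y -> ~~ crossing E F.
  by rewrite !inE => /or3P[]/eqP->; split=> //; exact: free.
have use (a b c a' b' c' : 'I_n) : a < b -> b < c ->
    interleave a a' b b' -> interleave b b' c c' -> interleave a a' c c' ->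
    {subset [:: [set a; a']; [set b; b']; [set c; c']]%SET <= [:: D0; D1; D2]} -> False.
  move=> ab bc /(interleave_lt ab)[_ ba' a'b'] /(interleave_lt bc)[_ _ b'c'].
  move=> /(interleave_lt (ltn_trans ab bc))[_ ca' _] sub.
  have ord : [/\ a < b, b < c, c < a', a' < b' & b' < c'] by [].
  apply: (three_crossing_exchanges Yd Yn cY4 n3 ord) => E /sub; exact: H.
have c10 := c01; rewrite interleaveC in c10; have c20 := c02; rewrite interleaveC in c20.
have c21 := c12; rewrite interleaveC in c21.
rewrite f0 f1 f2 in use; exfalso.
(* The three chords are sorted by their smaller endpoints. *)
have [i01|i01|/(interleave_neq c01)//] := ltngtP i0 i1;
have [i02|i02|/(interleave_neq c02)//] := ltngtP i0 i2;
have [i12|i12|/(interleave_neq c12)//] := ltngtP i1 i2.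
- by apply: (use i0 i1 i2 j0 j1 j2).
- apply: (use i0 i2 i1 j0 j2 j1) => // E; rewrite !inE; by case/or3P=> ->; rewrite ?orbT.
- by have := ltn_trans i01 i12; rewrite ltnNge ltnW.
- apply: (use i2 i0 i1 j2 j0 j1) => // E; rewrite !inE; by case/or3P=> ->; rewrite ?orbT.
- apply: (use i1 i0 i2 j1 j0 j2) => // E; rewrite !inE; by case/or3P=> ->; rewrite ?orbT.
- by have := ltn_trans i02 i12; rewrite ltnNge ltnW.
- apply: (use i1 i2 i0 j1 j2 j0) => // E; rewrite !inE; by case/or3P=> ->; rewrite ?orbT.
- apply: (use i2 i1 i0 j2 j1 j0) => // E; rewrite !inE; by case/or3P=> ->; rewrite ?orbT.
Qed.

End DiagonalSets.

(** * Connectedness of the flip graph *)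

Section FlipGraph.
Variable n : nat.
Hypothesis n_gt4 : 4 < n.
Implicit Types (x y : 'I_n * 'I_n) (D E F : {set 'I_n}) (T Y : {set {set 'I_n}}).

Let z : 'I_n := Ordinal (ltn_trans (isT : 0 < 4) n_gt4).

Definition degree T := #|[set D in T | z \in D]%SET|.
Definition fan : {set {set 'I_n}} := [set D in diagonals n | z \in D]%SET.

Lemma zero_chord (i j : 'I_n) : i < j -> (z \in [set i; j]%SET) = (i == 0 :> nat).
Proof.
by move=> ij; rewrite !inE -!val_eqE /= [0 == i]eq_sym; case: (i == 0 :> nat) => //=; lia.
Qed.

Lemma fan_noncrossing : noncrossing fan.
Proof.
apply/noncrossingP => D E; rewrite !inE => /andP[Dd Dz] /andP[Ed Ez].
have /diagonalP[i [j [/diagonal_lt ij eD]]] : D \in diagonals n by rewrite inE.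
have /diagonalP[k [l [/diagonal_lt kl eE]]] : E \in diagonals n by rewrite inE.
move: Dz Ez; rewrite eD eE !zero_chord // crossing_chord // /interleave; lia.
Qed.

Lemma fan_triangulation : is_triangulation fan.
Proof.
apply/triangulationP; split; first by apply/fintype.subsetP => D; rewrite inE => /andP[].
  have n1 : 1 < n by lia.
  have nn : n.-1 < n by lia.
  pose o1 : 'I_n := Ordinal n1; pose on : 'I_n := Ordinal nn.
  pose J := (~: (z |: (o1 |: [set on])))%SET.
  have inJ (j : 'I_n) : (j \in J) = nonadjacent n z j.
    by rewrite !inE -!val_eqE /= /nonadjacent; have := ltn_ord j; lia.
  have -> : fan = [set [set z; j]%SET | j in J]%SET.
    apply/setP => D; apply/idP/imsetP => [|[j]].
      rewrite !inE => /andP[Dd Dz].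
      have /diagonalP[i [j [ij eD]]] : D \in diagonals n by rewrite inE.
      move: Dz; rewrite eD zero_chord ?(diagonal_lt ij) // => /eqP i0.
      have ez : i = z by apply: val_inj.
      by exists j; rewrite ?ez // inJ -ez.
    rewrite inJ => dj ->; rewrite inE set21 andbT.
    by apply/diagonalP; exists z, j.
  rewrite card_in_imset => [|j k]; last first.
    by rewrite !inJ => /diagonal_lt lj /diagonal_lt lk /chord_inj[].
  have := cardsC (z |: (o1 |: [set on]))%SET; rewrite -/J card_ord !cardsU1 cards1.
  by rewrite !inE -!val_eqE /=; lia.
exact: fan_noncrossing.
Qed.

Lemma fan_unique T : is_triangulation T -> (forall D, D \in T -> z \in D) -> T = fan.
Proof.
move=> /triangulationP[/fintype.subsetP Td cT _] Tz; apply/eqP.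
rewrite eqEcard; apply/andP; split.
  by apply/fintype.subsetP => D DT; rewrite inE Td // Tz.
by rewrite cT; case/triangulationP: fan_triangulation => _ -> _.
Qed.

(** Among the chords of [T] that avoid the vertex [0], let [x], from [a] to [c],
    be one of maximal length. It is exchanged for the chord [G] from [0] to the
    apex [k] of the triangle that lies under [x], that is, the last [k < c]
    joined to [a]. A chord of [T] crossed by [G] passes over [k] and avoids [0].
    By the choice of [x] it lies under [x], and by the choice of [k] it is [x]
    itself. *)
Lemma flip_toward_fan T : is_triangulation T -> T != fan ->
  exists T', [/\ is_triangulation T', flip T T' & degree T < degree T'].
Proof.
move=> tT nfan; have [/fintype.subsetP Td cT /noncrossingP Tn] := triangulationP _ tT.
have [D0 D0T zD0] : exists2 D, D \in T & z \notin D.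
  apply/exists_inP; apply: contraT; rewrite negb_exists_in => /forall_inP H.
  by case/negP: nfan; apply/eqP/fan_unique => // D /H; rewrite negbK.
pose P x := [&& 0 < src x, src x < tgt x & chord x \in T].
have [x0 Px0] : exists x, P x.
  have /diagonal_chord[x /diagonal_lt lx eD] := Td _ D0T.
  exists x; rewrite /P lx -eD D0T !andbT lt0n; apply: contra zD0 => x1.
  by rewrite eD zero_chord.
have [x /and3P[x_gt0 lx xT] xmax] : exists2 x, P x & forall y, P y -> tgt y - src y <= tgt x - src x.
  by case: (@arg_maxnP _ x0 P (fun x => tgt x - src x) Px0) => x; exists x.
have dx : nonadjacent n (src x) (tgt x) by rewrite -chord_diagonal // Td.
pose Q (k : 'I_n) := [&& src x < k, k < tgt x &
  (k == (src x).+1 :> nat) || ([set x.1; k]%SET \in T)].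
have xn := tgt_lt x.
have [lt1 lt2] : (src x).+1 < tgt x /\ (src x).+1 < n.
  by clear -dx xn; move: dx; rewrite /nonadjacent; lia.
have Qk0 : Q (Ordinal lt2) by rewrite /Q /= ltnSn eqxx lt1.
have [k /and3P[ak kc Qk] kmax] : exists2 k, Q k & forall j, Q j -> j <= k.
  by case: (@arg_maxnP _ (Ordinal lt2) Q (fun i : 'I_n => i : nat) Qk0) => k; exists k.
pose G := [set z; k]%SET.
have zk : z < k by rewrite /=; exact: leq_ltn_trans ak.
have Gd : G \in diagonals n.
  apply/diagonalP; exists z, k; split=> //; clear -x_gt0 ak kc xn.
  by rewrite /nonadjacent /=; lia.
have crG (i j : 'I_n) : i < j -> crossing G [set i; j]%SET = [&& 0 < i, i < k & k < j].
  by move=> ij; rewrite crossing_chord // /interleave ltn0 orbF.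
have Gx : crossing G (chord x).
  by rewrite crG //; apply/and3P; split.
have GT : G \notin T by apply/negP => GT; have := Tn _ _ GT xT; rewrite Gx.
have Gn E : E \in T -> E != chord x -> ~~ crossing G E.
  move=> ET; have /diagonal_chord[y /diagonal_lt ly eE] := Td _ ET.
  rewrite eE => nyx; rewrite crG //; apply/negP => /and3P[y0 yk ky].
  rewrite -/(src y) -/(tgt y) in y0 yk ky.
  have Py : P y by rewrite /P y0 ly -eE.
  have le_y := xmax y Py.
  have nyx' : (src y != src x) || (tgt y != tgt x).
    apply: contraR nyx; rewrite negb_or !negbK => /andP[/eqP e1 /eqP e2].
    apply/eqP; congr chord; rewrite [y]surjective_pairing [x]surjective_pairing.
    by congr pair; apply: val_inj.
  have := Tn _ _ ET xT; rewrite eE crossing_chord // => ncr.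
  have [xy1 yx2] : src x <= src y /\ tgt y <= tgt x.
    clear -ncr nyx' le_y ak kc yk ky; move: ncr nyx'; rewrite /interleave.
    rewrite -!/(src _) -!/(tgt _); lia.
  have [e|ne] := eqVneq (src y) (src x).
    have : Q y.2.
      apply/and3P; split; rewrite -/(tgt y).
      - by rewrite -e.
      - by clear -nyx' e yx2; lia.
      - apply/orP; right; rewrite -(_ : y.1 = x.1); last exact: val_inj.
        by rewrite -[[set _; _]%SET]/(chord y) -eE.
    by move/kmax; rewrite -/(tgt y) leqNgt ky.
  case/orP: Qk => [/eqP kE|kT].
    by clear -kE yk xy1 ne; lia.
  have := Tn _ _ kT ET; rewrite eE crossing_chord //.
  rewrite -/(src x) -/(src y) -/(tgt y); clear -ne xy1 yk ky ly; rewrite /interleave; lia.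
exists (G |: (T :\ chord x))%SET; split.
- apply/triangulationP; split.
  + rewrite finset.subUset finset.sub1set Gd; apply/fintype.subsetP => E; rewrite !inE => /andP[_ /Td].
    by rewrite inE.
  + by rewrite cardsU1 !inE (negbTE GT) andbF -cT (cardsD1 (chord x) T) xT.
  apply: noncrossing_add => //.
    by apply/noncrossingP => E F /setD1P[_ ET] /setD1P[_ FT]; exact: Tn.
  by move=> E /setD1P[? ?]; exact: Gn.
- rewrite /flip (_ : T :\: _ = [set chord x])%SET ?cards1 //.
  apply/setP => E; rewrite !inE negb_or negb_and negbK.
  have [->|ne] := eqVneq E (chord x); last first.
    by case: (boolP (E \in T)); rewrite ?andbF // andbT orbF andbF.
  by rewrite xT !andbT; apply: contra GT => /eqP <-.
rewrite /degree; apply: proper_card; apply/properP; split; last first.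
  by exists G; rewrite !inE eqxx //= negb_and GT.
apply/fintype.subsetP => E; rewrite !inE => /andP[ET zE]; rewrite ET zE !andbT.
apply/orP; right; apply: contraL zE => /eqP ->.
by rewrite /chord zero_chord // -lt0n.
Qed.

End FlipGraph.

(** * A Hamiltonian cycle of pairwise disjoint triangulations *)

Section Rotations.
Variable n : nat.
Implicit Types (D E : {set 'I_n}) (T : {set {set 'I_n}}).

Lemma val_iter_ordS k (i : 'I_n) : iter k (@ordS n) i = (i + k) %% n :> nat.
Proof.
elim: k => [|k IH] /=; first by rewrite addn0 modn_small.
by rewrite IH -addn1 modnDml addn1 addnS.
Qed.

Lemma iter_turnD k D : iter k (@turnD n) D = [set iter k (@ordS n) x | x in D]%SET.
Proof.
elim: k => [|k IH] /=; first by rewrite imset_id.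
by rewrite IH /turnD -imset_comp.
Qed.

(** A rotation that fixes a chord without fixing its endpoints swaps them. *)
Lemma turnD_fixed_diameter k (i j : 'I_n) : i < j -> 0 < k < n ->
  iter k (@turnD n) [set i; j]%SET = [set i; j]%SET -> (j - i).*2 = n.
Proof.
move=> ij /andP[k0 kn]; rewrite iter_turnD imsetU !imset_set1 => e.
have mod2 (a : nat) : a < n -> (a + k) %% n = if a + k < n then a + k else a + k - n.
  move=> an; case: ltnP => [/modn_small//|le].
  by rewrite -[in LHS](subnK le) modnDr modn_small //; clear -an kn le; lia.
have := set21 (iter k (@ordS n) i) (iter k (@ordS n) j).
have := set22 (iter k (@ordS n) i) (iter k (@ordS n) j).
rewrite e !inE -!val_eqE /= !val_iter_ordS !mod2 //.
have := ltn_ord j; clear -ij k0 kn; move=> jn.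
by case: ifP; case: ifP; lia.
Qed.

(** Diameters enter only as the chords with fewer than [n] distinct rotated
    images. *)
Definition diameter D := [exists k : 'I_n, (0 < k) && (iter k (@turnD n) D == D)].

(** Two distinct chords that halve the polygon cross in its centre. *)
Lemma noncrossing_diameter D E : D \in diagonals n -> E \in diagonals n ->
  diameter D -> diameter E -> ~~ crossing D E -> D = E.
Proof.
move=> /diagonalP[i [j [/diagonal_lt ij ->]]] /diagonalP[k [l [/diagonal_lt kl ->]]].
move=> /existsP[a /andP[a0 /eqP ea]] /existsP[b /andP[b0 /eqP eb]].
have e1 := turnD_fixed_diameter ij (introT andP (conj a0 (ltn_ord a))) ea.
have e2 := turnD_fixed_diameter kl (introT andP (conj b0 (ltn_ord b))) eb.
rewrite crossing_chord // => ncr.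
have [e3 e4] : i = k :> nat /\ j = l :> nat.
  have := ltn_ord l; have := ltn_ord j; clear -e1 e2 ncr ij kl.
  by move: ncr; rewrite /interleave => *; split; lia.
by congr [set _; _]%SET; apply: val_inj.
Qed.

Lemma iter_turnD_inj_nondiameter D (k k' : nat) : ~~ diameter D -> k < n -> k' < n ->
  iter k (@turnD n) D = iter k' (@turnD n) D -> k = k'.
Proof.
move=> nd; wlog: k k' / k < k' => [wl kn k'n e|lt kn k'n].
  by case: (ltngtP k k') => // h; [apply: wl | apply/esym/wl].
rewrite -(subnK (ltnW lt)) addnC iterD => e; case/existsP: nd.
have ltk : k' - k < n by rewrite (leq_ltn_trans (leq_subr _ _)).
exists (Ordinal ltk); rewrite /= subn_gt0 lt /=.
have inj_iter : injective (iter k (@turnD n)).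
  by elim: (k) => [|m IH] A B //= /turnD_inj/IH.
by apply/eqP/inj_iter; rewrite -e.
Qed.

Lemma iter_turnT k T : iter k (@turnT n) T = [set iter k (@turnD n) D | D in T]%SET.
Proof.
elim: k => [|k IH] /=; first by rewrite imset_id.
by rewrite IH /turnT -imset_comp.
Qed.

End Rotations.

Section HamiltonianCycle.
Variable n : nat.
Hypothesis n_gt4 : 4 < n.
Let n_gt2 : 2 < n. Proof. exact: ltn_trans n_gt4. Qed.

Definition triangulation := {T : {set {set 'I_n}} | is_triangulation T}.
Implicit Types u v : triangulation.

Definition turnV u : triangulation := Sub (turnT (val u)) (turnT_triangulation (valP u)).

Lemma turnV_inj : injective turnV.
Proof. by move=> u v /(congr1 val) /turnT_inj /val_inj. Qed.

Definition rho : {perm triangulation} := perm turnV_inj.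

Lemma val_rho u : val (rho u) = turnT (val u).
Proof. by rewrite permE. Qed.

Lemma val_rhoX k u : val ((rho ^+ k)%g u) = iter k (@turnT n) (val u).
Proof.
by elim: k => [|k IH]; rewrite ?perm1 // expgSr permM val_rho IH.
Qed.

Definition apart u v := [disjoint val u & val v].
Definition flipV u v := flip (val u) (val v).

Lemma apartC : symmetric apart.
Proof. by move=> u v; rewrite /apart disjoint_sym. Qed.

Lemma apart_rho u v : apart (rho u) (rho v) = apart u v.
Proof. by rewrite /apart !val_rho imset_disjoint //; exact: turnD_inj. Qed.

Lemma apart_next u : apart u (rho u).
Proof. by rewrite /apart val_rho disjoint_turnT // (valP u). Qed.

Lemma flipVC : symmetric flipV.
Proof. by move=> u v; apply: flipC; exact: valP. Qed.

Lemma setD_iter k (S T : {set {set 'I_n}}) :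
  (iter k (@turnT n) S :\: iter k (@turnT n) T)%SET =
  [set iter k (@turnD n) D | D in S :\: T]%SET.
Proof.
have inj_iter : injective (iter k (@turnD n)).
  by elim: (k) => [|m IH] A B //= /turnD_inj/IH.
rewrite !iter_turnT; apply/setP => E; rewrite inE; apply/andP/imsetP.
  move=> [nT /imsetP[D DS eE]]; exists D => //; rewrite inE DS andbT.
  by apply: contra nT; rewrite eE => DT; apply/imsetP; exists D.
by move=> [D /setDP[DS DT] ->]; rewrite !mem_imset.
Qed.

Lemma flip_rho u v : flipV (rho u) (rho v) = flipV u v.
Proof.
rewrite /flipV /flip !val_rho (setD_iter 1) card_imset //; exact: turnD_inj.
Qed.

Lemma flip_apart u v : flipV u v -> exists2 w, w \in porbit rho v & apart u w.
Proof.
move=> /(flip_disjoint n_gt4 (valP u) (valP v)) /orP[d|d].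
  by exists (rho v); [exact: (mem_porbit rho 1) | rewrite /apart val_rho].
exists (rho^-1%g v); first by rewrite porbit_sym -{1}(permKV rho v) (mem_porbit rho 1).
by rewrite -apart_rho permKV apartC /apart val_rho.
Qed.

(** To each neighbouring orbit [Q] of [u] is attached a diagonal [g Q] of [u]
    whose flip leads into [Q]; the pair [(u, g Q)], up to simultaneous rotation,
    determines [Q]. If [g Q] is not a diameter, this pair has [n] distinct images
    under rotation. The orbit of [u], of length [m], provides [m * (n - 3)]
    pairs, hence fewer than [m] such neighbours; and at most one neighbour
    comes from a diameter. *)
Lemma card_nbr_orbits u : #|nbr_orbits flipV rho u| <= #|porbit rho u|.
Proof.
set N := nbr_orbits _ _ _; set m := #|porbit rho u|.
have [/fintype.subsetP ud cu /noncrossingP un] := triangulationP _ (valP u).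
pose P (Q : {set triangulation}) D := [exists v, (porbit rho v == Q) && ((val u :\: val v)%SET == [set D]%SET)].
pose g (Q : {set triangulation}) := odflt finset.set0 [pick D | P Q D].
have gP Q : Q \in N -> exists2 v, porbit rho v = Q & (val u :\: val v)%SET = [set g Q]%SET.
  move=> /imsetP[v Fuv ->]; rewrite /g; case: pickP => [D /existsP[w /andP[/eqP <- /eqP e]]|/=].
    by exists w.
  have /cards1P[D eD] : flip (val u) (val v) by [].
  by move=> /(_ D)/existsP[]; exists v; rewrite eD !eqxx.
have g_u Q : Q \in N -> g Q \in val u.
  move=> /gP[v _ e]; have : g Q \in (val u :\: val v)%SET by rewrite e set11.
  by case/setDP.
have g_inj k k' Q Q' : Q \in N -> Q' \in N -> (rho ^+ k)%g u = (rho ^+ k')%g u ->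
    iter k (@turnD n) (g Q) = iter k' (@turnD n) (g Q') -> Q = Q'.
  move=> /gP[v <- e] /gP[v' <- e'] eu eD.
  have eV w j D : (val u :\: val w)%SET = [set D]%SET ->
      (val ((rho ^+ j)%g u) :\: val ((rho ^+ j)%g w))%SET = [set iter j (@turnD n) D]%SET.
    by move=> ew; rewrite !val_rhoX setD_iter ew imset_set1.
  have e1 := eV _ k _ e; have e2 := eV _ k' _ e'; rewrite -eu -eD in e2.
  have /val_inj evv := flip_unique n_gt2 (valP _) (valP _) (valP _) e1 e2.
  by rewrite -(porbit_perm rho k v) evv porbit_perm.
pose N1 := [set Q in N | ~~ diameter (g Q)]%SET.
pose N2 := [set Q in N | diameter (g Q)]%SET.
have N2_le1 : #|N2| <= 1.
  apply/card_le1_eqP => Q Q' /setIdP[QN dQ] /setIdP[QN' dQ'].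
  apply: (g_inj 0 0 Q' Q QN' QN) => [//|]; rewrite /=.
  by apply: noncrossing_diameter; rewrite ?ud ?un ?g_u.
pose B := [set p : triangulation * {set 'I_n} | (p.1 \in porbit rho u) && (p.2 \in val p.1)]%SET.
have cardB : #|B| = m * (n - 3).
  rewrite -sum1_card (eq_bigl (fun p => (p.1 \in porbit rho u) && (p.2 \in val p.1))); last by move=> p; rewrite inE.
  rewrite -(pair_big_dep (mem (porbit rho u)) (fun v D => D \in val v) (fun _ _ => 1)) /=.
  rewrite -sum_nat_const; apply: eq_bigr => v _; rewrite sum1_card.
  by case/triangulationP: (valP v).
pose h (p : {set triangulation} * 'I_n) := ((rho ^+ p.2)%g u, iter p.2 (@turnD n) (g p.1)).
have le1 : #|N1| * n <= m * (n - 3).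
  rewrite -cardB -[n in #|N1| * n]card_ord -cardsT -cardsX -(@card_in_imset _ _ h).
    apply/subset_leq_card/fintype.subsetP => _ /imsetP[[Q k] /setXP[/= + _] ->].
    rewrite inE => /andP[QN _]; rewrite inE /h /= mem_porbit /=.
    by rewrite val_rhoX iter_turnT imset_f // g_u.
  move=> [Q k] [Q' k'] /setXP[/= + _] /setXP[/= + _].
  rewrite !inE => /andP[QN nd] /andP[QN' nd'] [/= e1 e2].
  have eQ := g_inj _ _ _ _ QN QN' e1 e2; rewrite -eQ in e2 *.
  by congr pair; apply: val_inj; exact: (iter_turnD_inj_nondiameter nd _ _ e2).
have m_gt0 : 0 < m by rewrite lt0n card_porbit_neq0.
have lt1 : #|N1| < m.
  rewrite -(ltn_pmul2r (ltn_trans (isT : 0 < 2) n_gt2)).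
  apply: leq_ltn_trans le1 _; rewrite ltn_pmul2l //; clear -n_gt2; lia.
have sN : N \subset N1 :|: N2.
  by apply/fintype.subsetP => Q QN; rewrite !inE QN /= orNb.
have := subset_leq_card sN; have [+ _] := leq_card_setU N1 N2; clear -N2_le1 lt1.
lia.
Qed.

Definition fanV : triangulation := Sub (fan n_gt4) (fan_triangulation n_gt4).

Lemma connect_fan u : connect flipV fanV u.
Proof.
rewrite (sym_connect_sym flipVC).
have le_deg v : degree n_gt4 (val v) <= n.
  apply: leq_trans (subset_leq_card (_ : _ \subset val v)) _.
    by apply/fintype.subsetP => D; rewrite inE => /andP[].
  by case/triangulationP: (valP v) => _ -> _; exact: leq_subr.
elim: {u}_.+1 {-2}u (ltnSn (n - degree n_gt4 (val u))) => // k IH u lt_k.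
have [e|ne] := eqVneq (val u) (fan n_gt4).
  by rewrite (_ : u = fanV) ?connect0 //; apply: val_inj.
have [T [tT FT dT]] := flip_toward_fan (valP u) ne.
pose v : triangulation := Sub T tT.
apply: (connect_trans (connect1 (_ : flipV u v))) => //.
apply: IH; have := le_deg v; have := le_deg u; move: dT lt_k; rewrite /v /=; clear; lia.
Qed.

(** The chord from [0] to [3] belongs to the fan at [0] but not to the one
    at [2]. *)
Lemma card_porbit_fan : 2 < #|porbit rho fanV|.
Proof.
have -> : 3 = #|[set fanV; rho fanV; rho (rho fanV)]%SET|.
  have d1 u : u != rho u.
    apply/eqP => e; have := apart_next u; rewrite -e /apart -setI_eq0 finset.setIid.
    by rewrite -cards_eq0; case/triangulationP: (valP u) => _ -> _; clear -n_gt4; lia.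
  have d2 : fanV != rho (rho fanV).
    apply/eqP => /(congr1 val); rewrite !val_rho /= => e.
    pose o3 : 'I_n := Ordinal (ltn_trans (isT : 3 < 4) n_gt4).
    pose o0 : 'I_n := Ordinal (ltn_trans (isT : 0 < 4) n_gt4).
    have : [set o0; o3]%SET \in fan n_gt4.
      rewrite inE; apply/andP; split; last by rewrite !inE -!val_eqE.
      apply/diagonalP; exists o0, o3; split=> //; rewrite /nonadjacent /=; clear -n_gt4; lia.
    rewrite e => /imsetP[D1 /imsetP[D]]; rewrite inE => /andP[_ zD] -> e2.
    have : ordS (ordS o0) \in [set o0; o3]%SET.
      rewrite e2 /turnD; apply: imset_f; apply: imset_f; move: zD; congr (_ \in _); exact: val_inj.
    by rewrite !inE -!val_eqE /= !modn_small //; clear -n_gt4; lia.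
  rewrite -finset.setUA !cardsU1 !inE cards1 negb_or d1 d2 /= (inj_eq perm_inj) d1.
  by [].
apply/subset_leq_card/fintype.subsetP => v; rewrite !inE => /orP[/orP[]|] /eqP->.
- exact: porbit_id.
- exact: (mem_porbit rho 1).
by rewrite -permM -expg2 mem_porbit.
Qed.

Theorem hamiltonian_cycle : exists c : seq triangulation,
  [/\ uniq c, path.cycle apart c & forall u, u \in c].
Proof.
exact: (hamiltonian_orbit_merging apartC apart_rho apart_next flipVC flip_rho
  flip_apart card_nbr_orbits card_porbit_fan connect_fan).
Qed.

End HamiltonianCycle.

(** * Catalan numbers *)

Section Catalan.

Lemma mulSn_catalan m : m.+1 * catalan m = 'C(2 * m, m).
Proof.
rewrite mulnC divnK //; have h : m.+1 * 'C(2 * m, m.+1) = m * 'C(2 * m, m).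
  by rewrite mul_bin_left; congr (_ * _); lia.
by rewrite -(Gauss_dvdr _ (coprimeSn m)) -h dvdn_mulr.
Qed.

Lemma catalanS m : m.+2 * catalan m.+1 = (4 * m + 2) * catalan m.
Proof.
apply/eqP; rewrite -(eqn_pmul2l (ltn0Sn m)); apply/eqP.
rewrite mulSn_catalan mulnCA mulSn_catalan.
have e1 : m.+1 * 'C(2 * m.+1, m.+1) = (2 * m.+1) * 'C((2 * m).+1, m).
  by rewrite -mul_bin_diag; congr (_ * 'C(_, _)); lia.
have e2 : m.+1 * 'C((2 * m).+1, m) = (2 * m).+1 * 'C(2 * m, m).
  rewrite -bin_sub; last by lia.
  by rewrite (_ : (2 * m).+1 - m = m.+1) -?mul_bin_diag //; lia.
by rewrite e1 -mulnA e2; lia.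
Qed.

(** With [S m] the sum in question and [W m] the same sum with weights [i + 1],
    the symmetry of [S m] gives [2 * W m = (m + 2) * S m]. On the other hand
    [catalanS], applied to the terms of [W m.+1] with positive index, expresses
    [W m.+1] through [S m] and [W m]. So [S m] determines [S m.+1]. *)
Lemma catalan_convolution m :
  \sum_(i < m.+1) catalan i * catalan (m - i) = catalan m.+1.
Proof.
pose S m := \sum_(i < m.+1) catalan i * catalan (m - i).
pose W m := \sum_(i < m.+1) i.+1 * (catalan i * catalan (m - i)).
have W_S k : 2 * W k = k.+2 * S k.
  have rW : W k = \sum_(i < k.+1) (k - i).+1 * (catalan i * catalan (k - i)).
    rewrite /W (reindex_inj rev_ord_inj) /=; apply: eq_bigr => i _.
    have ik := ltn_ord i; rewrite subSS (_ : k - (k - i) = i); last by lia.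
    by rewrite [catalan _ * _]mulnC.
  rewrite mul2n -addnn {1}rW /W -big_split /S big_distrr /=; apply: eq_bigr => i _.
  by have ik := ltn_ord i; rewrite -mulnDl; congr (_ * _); lia.
elim: m => [|m IH]; first by rewrite big_ord1.
rewrite -/(S m) in IH; rewrite -/(S m.+1); apply/eqP.
rewrite -(eqn_pmul2l (ltn0Sn m.+2)) -W_S catalanS; apply/eqP.
have -> : W m.+1 = catalan m.+1 + \sum_(i < m.+1) (4 * i + 2) * (catalan i * catalan (m - i)).
  rewrite /W big_ord_recl /= mul1n subn0 [catalan 0](_ : _ = 1) // mul1n; congr (_ + _).
  by apply: eq_bigr => i _; rewrite /bump /= add1n subSS !mulnA catalanS.
have -> : \sum_(i < m.+1) (4 * i + 2) * (catalan i * catalan (m - i)) = (2 * m.+1) * S m.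
  have : \sum_(i < m.+1) (4 * i + 2) * (catalan i * catalan (m - i)) + 2 * S m = 4 * W m.
    rewrite /S /W !big_distrr -big_split /=; apply: eq_bigr => i _.
    by rewrite -mulnDl [RHS]mulnA; congr (_ * _); lia.
  have e4 : 4 * W m = 2 * (2 * W m) by rewrite mulnA.
  move=> eq1; apply/eqP; rewrite -(eqn_add2r (2 * S m)) eq1 e4 W_S -mulnDl mulnA.
  by apply/eqP; congr (_ * _); lia.
by rewrite IH -mulSn mulnA; congr (_ * _); lia.
Qed.

End Catalan.

(** * The number of triangulations *)

Section Counting.
Variable n : nat.
Implicit Types (x y : 'I_n * 'I_n) (X L M : {set 'I_n * 'I_n}) (a k m i : nat).

(** The triangulations of the polygon with vertices [a], ..., [a + m + 1],
    including its top side. *)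
Definition max_families a m : {set {set 'I_n * 'I_n}} :=
  [set X | chord_family a m X && (#|X| == m)]%SET.

Definition splits a m k X := X \subset top_side a m X :|: (left_part k X :|: right_part k X).

(** The three parts have at most [1], [k - a - 1] and [a + m + 1 - k] elements,
    and these bounds add up to the size of [X]; so they are all attained. *)
Lemma max_family_split a m k X : X \in max_families a m.+1 -> a < k < a + m.+2 ->
    splits a m.+1 k X ->
  [/\ #|top_side a m.+1 X| = 1, left_part k X \in max_families a (k - a.+1)
    & right_part k X \in max_families k (a + m.+1 - k)].
Proof.
rewrite !inE => /andP[fX /eqP cX] /andP[ak kb] sX.
have fl := chord_family_left fX ak; have fr := chord_family_right fX kb.
have := subset_leq_card sX; have := card_top_side a m.+1 X.
have [+ _] := leq_card_setU (top_side a m.+1 X) (left_part k X :|: right_part k X).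
have [+ _] := leq_card_setU (left_part k X) (right_part k X).
have := chord_family_card_le fl; have := chord_family_card_le fr; rewrite fl fr cX; clear -ak kb.
move: #|_| #|_| #|_| #|_| #|_| => cr1 cr2 cr3 cr4 cr5 *.
by split=> /=; try apply/eqP; lia.
Qed.

Lemma max_family_has_split a m X : X \in max_families a m.+1 ->
  exists k, a < k < a + m.+2 /\ splits a m.+1 k X.
Proof.
by rewrite inE => /andP[/chord_family_split[k [ak kb sX _]] _]; exists k; rewrite ak [a + m.+2]addnS ltnS.
Qed.

Lemma max_family_top_side a m X : X \in max_families a m.+1 ->
  exists2 x, x \in X & src x = a /\ tgt x = a + m.+2.
Proof.
move=> mX; have [k [kab sX]] := max_family_has_split mX.
have [/eqP/cards1P[x ex] _ _] := max_family_split mX kab sX.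
have : x \in top_side a m.+1 X by rewrite ex set11.
by rewrite inE => /and3P[xX /eqP x1 /eqP x2]; exists x.
Qed.

(** If [k < k'] both split [X], the part to the left of [k'] contains its own top
    side, from [a] to [k'], which passes over [k]. *)
Lemma splits_unique a m k k' X : X \in max_families a m.+1 -> a < k < a + m.+2 ->
  a < k' < a + m.+2 -> splits a m.+1 k X -> splits a m.+1 k' X -> k = k'.
Proof.
move=> mX; wlog: k k' / k < k' => [wl kab kab' s s'|lt kab kab' s s'].
  by case: (ltngtP k k') => // h; [apply: wl | apply/esym/wl].
have [_ ml _] := max_family_split mX kab' s'.
have [j ej] : exists j, k' - a.+1 = j.+1 by exists (k' - a.+2); clear -lt kab kab'; lia.
rewrite ej in ml; have [x] := max_family_top_side ml; rewrite inE => /andP[xX _] [x1 x2].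
have := fintype.subsetP s x xX; rewrite !inE xX /= x1 x2; clear -ej lt kab kab'; lia.
Qed.

Lemma card_max_families0 a : #|max_families a 0| = 1.
Proof.
rewrite (_ : max_families a 0 = [set finset.set0]%SET) ?cards1 //; apply/setP => X.
rewrite !inE cards_eq0 andbC; case: eqP => // ->.
by apply/chord_familyP; split=> [x|x y]; rewrite inE.
Qed.

Definition side_pair a b (ha : a < n) (hb : b < n) : 'I_n * 'I_n := (Ordinal ha, Ordinal hb).

(** Triangulations with apex [k] are pairs of triangulations of the polygons to
    the left and to the right of [k]. *)
Lemma card_splits a m k : a + m.+2 < n -> a < k < a + m.+2 ->
  #|[set X in max_families a m.+1 | splits a m.+1 k X]%SET| =
  #|max_families a (k - a.+1)| * #|max_families k (a + m.+1 - k)|.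
Proof.
move=> bn kab; have ha : a < n by clear -bn; lia.
pose r := side_pair ha bn; have [ak kb] := andP kab.
pose U (p : {set 'I_n * 'I_n} * {set 'I_n * 'I_n}) := r |: (p.1 :|: p.2).
have facts L M : L \in max_families a (k - a.+1) -> M \in max_families k (a + m.+1 - k) ->
    (forall x, x \in L -> [/\ a <= src x, (src x).+1 < tgt x & tgt x <= k]) /\
    (forall x, x \in M -> [/\ k <= src x, (src x).+1 < tgt x & tgt x <= a + m.+2]).
  rewrite !inE => /andP[/chord_familyP[rL _] _] /andP[/chord_familyP[rM _] _].
  split=> x; [move=> /rL[h1 h2 h3] | move=> /rM[h1 h2 h3]]; split=> //;
    by clear -h1 h2 h3 ak kb; lia.
have r_src : src r = a by [].
have r_tgt : tgt r = a + m.+2 by [].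
have UK : {in finset.setX (max_families a (k - a.+1)) (max_families k (a + m.+1 - k)),
    cancel U (fun X => (left_part k X, right_part k X))}.
  move=> [L M] /setXP[/= mL mM]; have [rL rM] := facts L M mL mM.
  congr pair; apply/setP => x; rewrite !inE /=.
    apply/andP/idP => [[/or3P[/eqP->|//|/rM[h1 h2 _]]]|xL].
    - by rewrite r_tgt; clear -kb; lia.
    - by clear -h1 h2; lia.
    by have [_ _ ->] := rL x xL; rewrite xL orbT.
  apply/andP/idP => [[/or3P[/eqP->|/rL[_ h1 h2]|//]]|xM].
  - by rewrite r_src; clear -ak; lia.
  - by clear -h1 h2; lia.
  by have [-> _ _] := rM x xM; rewrite xM !orbT.
rewrite -cardsX -(card_in_imset (can_in_inj UK)); congr #|pred_of_set _|.
apply/setP => X; apply/setIdP/imsetP => [[mX sX]|[[L M] /setXP[/= mL mM] ->]].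
  have [_ ml mr] := max_family_split mX kab sX.
  exists (left_part k X, right_part k X); first exact/setXP.
  have [x xX [x1 x2]] := max_family_top_side mX.
  have er : x = r.
    by rewrite [x]surjective_pairing; congr pair; apply: val_inj.
  apply/setP => y; rewrite !inE /=; apply/idP/idP => [yX|].
    have := fintype.subsetP sX y yX; rewrite !inE yX /= => /orP[|->]; last by rewrite orbT.
    move=> /andP[/eqP y1 /eqP y2]; apply/orP; left; apply/eqP.
    by rewrite -er [y]surjective_pairing [x]surjective_pairing; congr pair; apply: val_inj;
      [exact: (etrans y1 (esym x1)) | exact: (etrans y2 (esym x2))].
  by case/or3P=> [/eqP->|/andP[]//|/andP[]//]; rewrite -er.
have [rL rM] := facts L M mL mM.
have rLM : r \notin L :|: M.
  rewrite inE; apply/negP => /orP[/rL|/rM]; rewrite r_src r_tgt => -[]; clear -ak kb; lia.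
have dLM : L :&: M = finset.set0.
  apply/setP => x; rewrite !inE; apply/negP => /andP[/rL[_ h1 h2] /rM[h3 _ _]].
  by clear -h1 h2 h3; lia.
move: mL mM; rewrite !inE => /andP[/chord_familyP[_ nL] /eqP cL] /andP[/chord_familyP[_ nM] /eqP cM].
have bnds x : x \in r |: (L :|: M) -> [/\ a <= src x, (src x).+1 < tgt x & tgt x <= a + m.+2].
  rewrite !inE => /or3P[/eqP->|/rL[h1 h2 h3]|/rM[h1 h2 h3]].
  - by rewrite r_src r_tgt; clear; split; lia.
  - by split=> //; clear -h3 kb; lia.
  by split=> //; clear -h1 ak; lia.
split; last first.
  apply/fintype.subsetP => x; rewrite !inE => /or3P[/eqP->|xL|xM].
  - by rewrite r_src r_tgt !eqxx.
  - by have [_ _ ->] := rL x xL; rewrite xL !orbT.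
  by have [-> _ _] := rM x xM; rewrite xM !orbT.
apply/andP; split; last first.
  rewrite cardsU1 rLM cardsU dLM cards0 cL cM; clear -ak kb; apply/eqP; lia.
apply/chord_familyP; split=> // x y xU yU.
have cr_r u : u \in r |: (L :|: M) -> ~~ interleave a (a + m.+2) (src u) (tgt u).
  by move=> /bnds[h1 h2 h3]; clear -h1 h2 h3; rewrite /interleave; lia.
have cr_LM u v : u \in L -> v \in M -> ~~ interleave (src u) (tgt u) (src v) (tgt v).
  move=> /rL[h1 h2 h3] /rM[h4 h5 h6]; clear -h1 h2 h3 h4 h5 h6.
  by rewrite /interleave; lia.
have [/setU1P[->|xLM] /setU1P[e|yLM]] := (xU, yU).
- by rewrite r_src r_tgt cr_r.
- by rewrite r_src r_tgt cr_r.
- by rewrite e interleaveC r_src r_tgt cr_r.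
move: xLM yLM => /setUP[xL|xM] /setUP[yL|yM].
- exact: nL.
- exact: cr_LM.
- by rewrite interleaveC cr_LM.
exact: nM.
Qed.

(** Summing over the position of the apex gives the convolution of Catalan
    numbers. *)
Theorem card_max_families m a : a + m.+1 < n -> #|max_families a m| = catalan m.
Proof.
elim/ltn_ind: m a => -[|m] IH a bn; first by rewrite card_max_families0.
rewrite -catalan_convolution.
pose f X := odflt ord0 [pick i : 'I_m.+1 | splits a m.+1 (a + i.+1) X].
rewrite -sum1_card (partition_big f xpredT) //=; apply: eq_bigr => i _.
have im := ltn_ord i.
have kab : a < a + i.+1 < a + m.+2 by clear -im; lia.
rewrite -[LHS](_ : #|[set X in max_families a m.+1 | splits a m.+1 (a + i.+1) X]%SET| = _).
  rewrite card_splits //.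
  have -> : a + i.+1 - a.+1 = i by clear; lia.
  have -> : a + m.+1 - (a + i.+1) = m - i by clear; lia.
  by rewrite !IH //; clear -im bn; lia.
rewrite -sum1_card; apply: eq_bigl => X; rewrite inE.
have [mX /=|//] := boolP (X \in max_families a m.+1).
rewrite /f; case: pickP => [j sj|none] /=.
  apply/idP/eqP => [si|<-//]; apply: val_inj; have jm := ltn_ord j.
  have kab' : a < a + j.+1 < a + m.+2 by clear -jm; lia.
  by have /eqP := splits_unique mX kab' kab sj si; rewrite eqn_add2l eqSS => /eqP.
have [k [/andP[ak kb] sX]] := max_family_has_split mX.
have lt : k - a.+1 < m.+1 by clear -ak kb; lia.
have := none (Ordinal lt); rewrite /= (_ : a + (k - a.+1).+1 = k) ?sX //.
by clear -ak; lia.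
Qed.

Hypothesis n_gt2 : 2 < n.

Theorem card_triangulations : #|triangulations n| = catalan (n - 2).
Proof.
rewrite -(@card_max_families (n - 2) 0); last by clear -n_gt2; lia.
pose r := long_side n_gt2.
have rdef X x : x \in X -> src x = 0 -> tgt x = n.-1 -> x = r.
  move=> _ x1 x2; rewrite [x]surjective_pairing; congr pair; exact: val_inj.
pose f T := r |: pairs_of T.
have Td T : T \in triangulations n -> T \subset diagonals n.
  by rewrite inE => /triangulationP[].
rewrite -(@card_in_imset _ _ f) => [|T T' /Td dT /Td dT' /(congr1 (fun A : {set _} => A :\ r))]; last first.
  rewrite !setU1K ?long_side_pairs // => e.
  by rewrite -(pairs_ofE dT) e pairs_ofE.
congr #|pred_of_set _|; apply/setP => X; apply/imsetP/idP => [[T tT ->]|mX].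
  have dT := Td T tT; move: tT; rewrite !inE => /triangulationP[_ cT nT].
  rewrite /f chord_family_pairs_of //= cardsU1 long_side_pairs // card_pairs_of // cT.
  by apply/eqP; clear -n_gt2; lia.
have mX' : X \in max_families 0 (n - 3).+1 by rewrite (_ : (n - 3).+1 = n - 2) //; clear -n_gt2; lia.
have [x xX [x1 x2]] := max_family_top_side mX'.
have xr : x = r by apply: rdef xX _ _ => //; rewrite x2; clear -n_gt2; lia.
rewrite xr in xX; move: mX; rewrite inE => /andP[/chord_familyP[rX nX] /eqP cX].
have lt y : y \in X -> src y < tgt y by move=> /rX[_ h _]; clear -h; lia.
pose T : {set {set 'I_n}} := [set chord y | y in X :\ r]%SET.
have chinj : {in X &, injective (@chord n)}.
  by move=> y y' /lt ly /lt ly'; exact: chord_pair_inj.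
have chinj' : {in X :\ r &, injective (@chord n)}.
  by move=> y y' /setD1P[_ yX] /setD1P[_ yX']; exact: chinj.
have dT : T \subset diagonals n.
  apply/fintype.subsetP => _ /imsetP[y /setD1P[yr yX] ->]; rewrite chord_diagonal ?lt //.
  have [_ h _] := rX y yX; rewrite /nonadjacent h; apply: contra yr => /andP[/eqP y1 /eqP y2].
  by rewrite (rdef X y).
have pT : pairs_of T = X :\ r.
  apply/setP => y; rewrite inE; apply/andP/idP => [[ly /imsetP[y' yX' /chord_pair_inj->//]]|yX].
    by apply: lt; case/setD1P: yX'.
  by split; [apply: lt; case/setD1P: yX | exact: imset_f].
exists T; last by rewrite /f pT finset.setD1K.
rewrite inE; apply/triangulationP; split=> //.
  by rewrite card_in_imset //; have := cardsD1 r X; rewrite xX cX; clear -n_gt2; lia.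
apply/noncrossingP => _ _ /imsetP[y /setD1P[_ yX] ->] /imsetP[y' /setD1P[_ yX'] ->].
by rewrite crossing_chord ?lt // nX.
Qed.

End Counting.

Local Open Scope classical_set_scope.
Local Open Scope ring_scope.

(** * Linear inequalities *)

Section Functionals.
Variables (R : comNzRingType) (d : nat).
Implicit Types (c e : 'cV[R]_d) (x y : 'rV[R]_d) (t : R).

(** Column vectors act as linear functionals on row vectors, as in the
    definition of faces. *)
Definition ev c x : R := (x *m c) 0 0.

Lemma evD c x y : ev c (x + y) = ev c x + ev c y.
Proof. by rewrite /ev mulmxDl mxE. Qed.
Lemma evB c x y : ev c (x - y) = ev c x - ev c y.
Proof. by rewrite /ev mulmxBl !mxE. Qed.
Lemma evZ c t x : ev c (t *: x) = t * ev c x.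
Proof. by rewrite /ev -scalemxAl mxE. Qed.
Lemma ev_sum c I r (F : I -> 'rV[R]_d) : ev c (\sum_(i <- r) F i) = \sum_(i <- r) ev c (F i).
Proof. by rewrite /ev mulmx_suml summxE. Qed.
Lemma evDr c e x : ev (c + e) x = ev c x + ev e x.
Proof. by rewrite /ev mulmxDr mxE. Qed.
Lemma evBr c e x : ev (c - e) x = ev c x - ev e x.
Proof. by rewrite /ev mulmxBr !mxE. Qed.
Lemma evZr t c x : ev (t *: c) x = t * ev c x.
Proof. by rewrite /ev -scalemxAr mxE. Qed.
Lemma evNr c x : ev (- c) x = - ev c x.
Proof. by rewrite /ev mulmxN mxE. Qed.
Lemma evN c x : ev c (- x) = - ev c x.
Proof. by rewrite /ev mulNmx mxE. Qed.
End Functionals.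

Section Farkas.
Variables (R : realFieldType) (d : nat).
Implicit Types (c : 'cV[R]_d) (g : 'rV[R]_d) (a : nat -> 'rV[R]_d).

(** Bartl's induction on the number of generators. If [g] is nonpositive already
    wherever the first [m] generators are, the last one gets coefficient zero. Otherwise
    a functional [b] with [ev b (a m) > 0] is nonpositive on the first [m]
    generators and positive on [g]; subtracting multiples of [a m] puts [g] and
    the other generators into the kernel of [b], and the induction hypothesis
    applies to the projected vectors. *)
Lemma farkas m a g :
    (forall c, (forall i, (i < m)%N -> ev c (a i) <= 0) -> ev c g <= 0) ->
  exists2 l : nat -> R, (forall i, 0 <= l i) & g = \sum_(i < m) l i *: a i.
Proof.
elim: m a g => [|m IH] a g gle.
  exists (fun=> 0) => //; rewrite big_ord0; apply/rowP => j; rewrite mxE.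
  have evj : ev (delta_mx j 0) g = g 0 j by rewrite /ev -colE mxE.
  have := gle (- delta_mx j 0) (fun i (h : (i < 0)%N) => False_ind _ (notF h)).
  have := gle (delta_mx j 0) (fun i (h : (i < 0)%N) => False_ind _ (notF h)).
  by rewrite evNr evj => *; lra.
have [gle'|] := pselect (forall c, (forall i, (i < m)%N -> ev c (a i) <= 0) -> ev c g <= 0).
  have [l l_ge0 ->] := IH a g gle'.
  exists (fun i => if (i < m)%N then l i else 0) => [i|]; first by case: ifP.
  rewrite big_ord_recr /= ltnn scale0r addr0.
  by apply: eq_bigr => i _; rewrite ltn_ord.
move=> /existsNP[b /not_implyP[ble /negP]]; rewrite -ltNge => bg.
have bm : 0 < ev b (a m).
  rewrite ltNge; apply/negP => bm; have := gle b; rewrite leNgt bg => /(_ _)/negP; apply=> //.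
  by move=> i; rewrite ltnS leq_eqVlt => /orP[/eqP->|/ble].
pose al := ev b (a m); have al0 : al != 0 by rewrite gt_eqF.
have [|l l_ge0 eg] := IH (fun i => a i - (ev b (a i) / al) *: a m) (g - (ev b g / al) *: a m).
  move=> c cle; pose c2 := c - (ev c (a m) / al) *: b.
  have ec2 x : ev c2 x = ev c (x - (ev b x / al) *: a m).
    by rewrite /c2 evBr evZr evB evZ; ring.
  rewrite -ec2; apply: gle => i; rewrite ltnS leq_eqVlt => /orP[/eqP->|lt_im].
    by rewrite ec2 divff // scale1r subrr /ev mul0mx mxE.
  by rewrite ec2 cle.
exists (fun i => if (i < m)%N then l i else
   ev b g / al - \sum_(i < m) l i * (ev b (a i) / al)) => [i|].
  case: ifP => // _; rewrite subr_ge0.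
  apply: (@le_trans _ _ 0); last by rewrite divr_ge0 // ltW.
  rewrite -oppr_ge0 -sumrN sumr_ge0 // => j _.
  by rewrite -mulrN mulr_ge0 // -mulNr divr_ge0 ?oppr_ge0 ?ble ?(ltW bm).
rewrite big_ord_recr /= ltnn -[LHS](subrK ((ev b g / al) *: a m)) eg.
rewrite scalerBl addrA addrAC; congr (_ + _).
rewrite scaler_suml -sumrB; apply: eq_bigr => i _.
by rewrite ltn_ord scalerBr scalerA.
Qed.

(** Under the hypothesis, Farkas' lemma writes each [- v j] as a nonnegative
    combination of the [v i]; adding up these relations gives every vector a
    coefficient of at least [1]. *)
Lemma stiemke k (v : nat -> 'rV[R]_d) :
    (forall c, (forall i, (i < k)%N -> ev c (v i) <= 0) ->
       forall i, (i < k)%N -> ev c (v i) = 0) ->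
  exists2 l : nat -> R, (forall i, 0 < l i) & \sum_(i < k) l i *: v i = 0.
Proof.
move=> all0.
have /choice[L HL] : forall j, exists l : nat -> R, (forall i, 0 <= l i) /\
    ((j < k)%N -> - v j = \sum_(i < k) l i *: v i).
  move=> j; have [ltjk|] := boolP (j < k)%N; last by exists (fun=> 0).
  have [|l l0 e] := @farkas k v (- v j); last by exists l.
  by move=> c cle; rewrite evN all0 // oppr0.
exists (fun i => 1 + \sum_(j < k) L j i) => [i|].
  by rewrite ltr_pwDl // sumr_ge0 // => j _; have [] := HL j.
under eq_bigr do rewrite scalerDl scale1r scaler_suml.
rewrite big_split /= exchange_big /= -big_split /= big1 // => j _.
by have [_ <-] := HL j; rewrite ?subrr.
Qed.
End Farkas.

(** * Boundary points of a polytope lie on facets *)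

Lemma seq_argmin (R : realType) (T : eqType) (f : T -> R) (r : seq T) :
  r != [::] -> exists2 x, x \in r & forall y, y \in r -> f x <= f y.
Proof.
elim: r => // x r IH _; have [->|/IH[y yr ymin]] := eqVneq r [::].
  by exists x; rewrite ?mem_head // => y; rewrite inE => /eqP->.
have [le_xy|lt_yx] := leP (f x) (f y).
  exists x; rewrite ?mem_head // => u; rewrite inE => /predU1P[->//|/ymin].
  exact: le_trans.
exists y; rewrite ?inE ?yr ?orbT // => u; rewrite inE => /predU1P[->|/ymin//].
exact: ltW.
Qed.

Lemma count_lt (T : eqType) (p q : pred T) (r : seq T) x :
  {in r, subpred p q} -> x \in r -> q x -> ~~ p x -> (count p r < count q r)%N.
Proof.
elim: r => // y r IH pq; have pq' : {in r, subpred p q}.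
  by move=> u ur; apply: pq; rewrite inE ur orbT.
have le : (p y <= q y)%N by case: (p y) (pq y (mem_head _ _)) => // ->.
rewrite inE /= => /predU1P[->|xr] qx px; last by rewrite -addnS leq_add // IH.
rewrite qx (negbTE px) /= add0n add1n ltnS.
elim: r pq' {IH pq} => //= u r IH pq; rewrite leq_add ?IH // => [|v vr].
  by case: (p u) (pq u (mem_head _ _)) => // ->.
by apply: pq; rewrite inE vr orbT.
Qed.

Section Polytopes.
Variables (R : realType) (d : nat).
Implicit Types (c e : 'cV[R]_d) (x y z : 'rV[R]_d) (S P F : set 'rV[R]_d)
  (s t : seq 'rV[R]_d) (U W : {vspace 'rV[R]_d}).

(** A coordinate of the projection along [W] that does not vanish at [x]. *)
Lemma vspace_functional W x : x \notin W ->
  exists e, (forall w, w \in W -> ev e w = 0) /\ 0 < ev e x.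
Proof.
move=> xW; pose f := (\1 - projv W)%VF.
have fE y : f y = y - projv W y by rewrite /f add_lfunE opp_lfunE id_lfunE.
have /rV0Pn[j fj] : f x != 0.
  by rewrite fE subr_eq0; apply: contra xW => /eqP->; exact: memv_proj.
have evf y : ev (col j (lin1_mx f)) y = f y 0 j.
  by rewrite /ev colE mulmxA mul_rV_lin1 -colE mxE.
exists ((f x 0 j)^-1 *: col j (lin1_mx f)); split=> [w wW|].
  by rewrite evZr evf (fE w) projv_id // subrr mxE mulr0.
by rewrite evZr evf mulVf // ltr01.
Qed.

Lemma ev_span0 c s x :
  x \in span s -> (forall u, u \in s -> ev c u = 0) -> ev c x = 0.
Proof.
move=> /(@coord_span _ _ _ (in_tuple s)) -> cs; rewrite ev_sum big1 // => i _.
by rewrite evZ cs ?mulr0 // mem_nth.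
Qed.

Definition directions z s : seq 'rV[R]_d := [seq x - z | x <- s].

(** A point of [z] plus the span is an affine combination of the points of [t]
    and of [z], with weight [1 - \sum_j a j] on [z]. *)
Lemma affine_hull_span S z t :
    S z -> (forall x, x \in t -> S x) ->
    (forall x, S x -> x - z \in <<directions z t>>%VS) ->
  affine_hull S = [set z + u | u in [set` <<directions z t>>%VS]].
Proof.
move=> Sz St Sspan; apply/seteqP; split=> x /=.
  move=> [k [p [w [Sp w1 ->]]]]; exists (\sum_i w i *: (p i - z)).
    by apply: rpred_sum => i _; rewrite rpredZ // Sspan.
  under eq_bigr do rewrite scalerBr.
  by rewrite sumrB -scaler_suml w1 scale1r addrC subrK.
move=> [u uW <-]; have sz : size (directions z t) == size t by rewrite size_map.
pose X := Tuple sz; pose a := fun j => coord X j u.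
have ue : u = \sum_j a j *: (t`_j - z).
  rewrite (coord_span (uW : u \in <<X>>%VS)); apply: eq_bigr => j _.
  by congr (_ *: _); rewrite (nth_map 0).
exists (size t).+1, (fun i => if unlift ord0 i is Some j then t`_j else z),
  (fun i => if unlift ord0 i is Some j then a j else 1 - \sum_j a j); split.
- by move=> i; case: unliftP => // j _; apply: St; rewrite mem_nth.
- rewrite big_ord_recl unlift_none; under [X in _ + X]eq_bigr do rewrite liftK.
  by rewrite subrK.
rewrite big_ord_recl unlift_none; under [X in _ = _ + X]eq_bigr do rewrite liftK.
have {1}-> : u = \sum_j a j *: t`_j - (\sum_j a j) *: z.
  by rewrite scaler_suml -sumrB {1}ue; apply: eq_bigr => j _; rewrite scalerBr.
by rewrite scalerBl scale1r addrCA addrC.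
Qed.

Lemma affine_directions x z U W :
  [set x + u | u in [set` U]] = [set z + w | w in [set` W]] -> U = W.
Proof.
move=> e.
have sub y y' (A B : {vspace 'rV[R]_d}) : [set y + u | u in [set` A]] `<=` [set y' + w | w in [set` B]] ->
    (A <= B)%VS.
  move=> AB; apply/subvP => u uA.
  have /AB[w wB /= ew] : [set y + u | u in [set` A]] (y + u) by exists u.
  have /AB[w0 w0B /= ew0] : [set y + u | u in [set` A]] y.
    by exists 0; rewrite ?addr0 //=; exact: mem0v.
  have -> : u = w - w0.
    by apply: (addrI y); rewrite -ew -[in RHS]ew0 -addrA [w0 + _]addrC subrK.
  exact: memvB.
by apply/eqP; rewrite eqEsubv (sub x z) ?(sub z x) ?e.
Qed.

Lemma has_dim_span S z t m :
    S z -> (forall x, x \in t -> S x) ->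
    (forall x, S x -> x - z \in <<directions z t>>%VS) ->
  has_dim S m <-> \dim <<directions z t>>%VS = m.
Proof.
move=> Sz St Sspan; have e := affine_hull_span Sz St Sspan.
split=> [[x [U [eU <-]]]|<-]; last by exists z, <<directions z t>>%VS.
by rewrite (@affine_directions x z U <<directions z t>>%VS) // -eU e.
Qed.

Lemma convex_hull_sub s x : x \in s -> convex_hull [set` s] x.
Proof.
move=> xs; exists 1%N, (fun=> x), (fun=> 1); rewrite !big_ord1 scale1r.
by split.
Qed.

Lemma convex_hull_span z s x :
  convex_hull [set` s] x -> x - z \in <<directions z s>>%VS.
Proof.
move=> [k [p [w [sp _ w1 ->]]]].
have -> : \sum_i w i *: p i - z = \sum_i (w i *: p i - w i *: z).
  by rewrite sumrB -scaler_suml w1 scale1r.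
rewrite rpred_sum // => i _; have si := sp i.
by rewrite -scalerBr rpredZ // memv_span //; apply/mapP; exists (p i) => //.
Qed.

Lemma convex_hull_convex S x y (a : R) : 0 <= a <= 1 ->
  convex_hull S x -> convex_hull S y -> convex_hull S ((1 - a) *: x + a *: y).
Proof.
move=> /andP[a0 a1] [k [p [w [Sp w0 w1 ->]]]] [l [q [u [Sq u0 u1 ->]]]].
exists (k + l)%N, (fun i => match fintype.split i with inl j => p j | inr j => q j end),
  (fun i => match fintype.split i with inl j => (1 - a) * w j | inr j => a * u j end).
have sl (A : Type) (f : 'I_k -> A) (g : 'I_l -> A) i :
    match fintype.split (lshift l i) with inl j => f j | inr j => g j end = f i.
  by rewrite -[lshift l i]/(unsplit (inl i)) unsplitK.
have sr (A : Type) (f : 'I_k -> A) (g : 'I_l -> A) i :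
    match fintype.split (rshift k i) with inl j => f j | inr j => g j end = g i.
  by rewrite -[rshift k i]/(unsplit (inr i)) unsplitK.
split.
- by move=> i; case: (fintype.split i).
- by move=> i; case: (fintype.split i) => j; rewrite mulr_ge0 ?subr_ge0.
- rewrite big_split_ord /=; under eq_bigr do rewrite sl.
  under [X in _ + X]eq_bigr do rewrite sr.
  by rewrite -!mulr_sumr w1 u1 !mulr1 subrK.
rewrite big_split_ord /= !scaler_sumr; congr (_ + _); apply: eq_bigr => i _.
  by rewrite !sl scalerA.
by rewrite !sr scalerA.
Qed.

Lemma cvg_sumr (I T : Type) (F : set_system T) {FF : Filter F} (r : seq I)
    (f : I -> T -> R) (l : I -> R) :
    (forall i, f i u @[u --> F] --> l i) ->
  \sum_(i <- r) f i u @[u --> F] --> \sum_(i <- r) l i.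
Proof.
move=> fl; elim: r => [|i r IH].
  have -> : (fun u => \sum_(i <- [::]) f i u) = fun=> 0.
    by apply/funext => u; rewrite big_nil.
  by rewrite big_nil; exact: cvg_cst.
have -> : (fun u => \sum_(j <- i :: r) f j u) = f i \+ (fun u => \sum_(j <- r) f j u).
  by apply/funext => u; rewrite big_cons.
by rewrite big_cons; exact: cvgD.
Qed.

Lemma scalar_continuous (f : {scalar 'rV[R]_d}) : continuous (f : 'rV[R]_d -> R).
Proof.
move=> y; have fE u : f u = \sum_i u 0 i * f (delta_mx 0 i).
  by rewrite {1}[u]row_sum_delta linear_sum; apply: eq_bigr => i _; rewrite linearZ.
have -> : (f : _ -> _) = fun u => \sum_i u 0 i * f (delta_mx 0 i) by exact/funext.
apply: (cvg_sumr (F := nbhs y)) => i; apply: cvgMr_tmp; exact: coord_continuous.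
Qed.

(** A point of the affine hull is [z] plus a combination of the vectors
    [s`_i - z], with coefficients [a i y] that depend continuously on [y] and
    vanish at [z]. Adding the multiple [tt y] of the given positive relation
    makes the coefficients add up to [1]; near [z] they are still positive, so
    that [y] is a convex combination of the points of [s]. *)
Lemma relative_interior_positive z s (l : nat -> R) :
    convex_hull [set` s] z -> (forall i, 0 < l i) ->
    \sum_(i < size s) l i *: (s`_i - z) = 0 ->
  relative_interior (convex_hull [set` s]) z.
Proof.
move=> Pz l0 lz; split=> //.
have sz : size (directions z s) == size s by rewrite size_map.
pose X := Tuple sz; pose a j (y : 'rV[R]_d) : R := coord X j (y - z).
have s0 : 0 < \sum_(i < size s) l i.
  case: s Pz l0 lz sz @X @a => [[k [p [w [sp _ w1 _]]]]|x s _ l0 _ _ _ _].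
    case: k p w sp w1 => [p w _|k p w sp _]; last by have := sp ord0.
    by rewrite big_ord0 => /eqP; rewrite eq_sym oner_eq0.
  rewrite /= big_ord_recl ltr_wpDr // sumr_ge0 // => i _; exact: ltW.
pose tt y := (1 - \sum_j a j y) / \sum_(i < size s) l i.
pose w j y := a j y + tt y * l j.
have w_cont j : w j y @[y --> z] --> w j z.
  have: forall j, coord X j y @[y --> z] --> coord X j z.
    by move=> i; exact: (@scalar_continuous (coord X i)).
  have: Filter (nbhs z) by exact: nbhs_filter.
  rewrite /w /tt /a; move: (nbhs z) => F FF cX.
  have a_cont i : coord X i (y - z) @[y --> F] --> coord X i (z - z).
    rewrite linearB.
    have -> : (fun y => coord X i (y - z)) = fun y => coord X i y - coord X i z.
      by apply/funext => y; rewrite linearB.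
    by apply: cvgB; [exact: cX | exact: cvg_cst].
  apply: cvgD => //; apply: cvgMr_tmp; apply: cvgMr_tmp.
  by apply: cvgB; [exact: cvg_cst | exact: cvg_sumr].
have wz j : 0 < w j z.
  rewrite /w /tt /a subrr linear0 add0r big1 ?subr0 ?mul1r => [|i _]; last by rewrite linear0.
  by rewrite mulr_gt0 // invr_gt0.
have : \forall y \near z, forall j, 0 < w j y.
  apply: (filter_forall (F := nbhs z)) => j.
  have h := @cvgr_gt _ _ (nbhs z) _ (w j) (w j z) (w_cont j) 0 (wz j).
  exact: h.
rewrite /within /=; apply: (filterS (F := nbhs z)) => y wy yaff.
have : y - z \in <<X>>%VS.
  have := affine_hull_span Pz (@convex_hull_sub s) (@convex_hull_span z s).
  move: yaff => /[swap] -> [u uW <-]; by rewrite addrC addKr.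
move=> /coord_span yE.
have w1 : \sum_j w j y = 1.
  by rewrite /w big_split /= -mulr_sumr /tt mulfVK ?gt_eqF // addrC subrK.
exists (size s), (fun i => s`_i), (fun i => w i y); split.
- by move=> i; rewrite /= mem_nth.
- by move=> i; exact: ltW.
- exact: w1.
have yz : y - z = \sum_i w i y *: (s`_i - z).
  rewrite {1}yE /w; under [RHS]eq_bigr do rewrite scalerDl -scalerA.
  rewrite big_split /= -scaler_sumr lz scaler0 addr0; apply: eq_bigr => i _.
  by congr (_ *: _); rewrite (nth_map 0).
apply: (addIr (- z)); rewrite yz; under eq_bigr do rewrite scalerBr.
by rewrite sumrB -scaler_suml w1 scale1r.
Qed.

(** For [z] in the convex hull of [s], the functional [c] attains its maximum over
    the hull at [z] without being constant on it: it cuts out a proper face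
    through [z]. *)
Definition supports s z c :=
  (forall x, x \in s -> ev c (x - z) <= 0) /\ exists2 x, x \in s & ev c (x - z) < 0.

Definition zeros s z c := [seq x <- s | ev c (x - z) == 0].

(** If the face through [z] has codimension at least two, some functional [e]
    vanishes on its directions and on one further direction [x0 - z], but not on
    all directions of [s]. Rotating the hyperplane, from [c] towards [e], until
    it hits a new point [x2] enlarges the face; [x0] stays off it. *)
Lemma supports_rotate s z c :
    supports s z c ->
    ((\dim <<directions z (zeros s z c)>>).+1 < \dim <<directions z s>>)%N ->
  exists2 c', supports s z c' & (size (zeros s z c) < size (zeros s z c'))%N.
Proof.
move=> [cle [x0 x0s cx0]] ltd; set t := zeros s z c in ltd *.
pose W := (<<directions z t>> + <[(x0 - z)]>)%VS.
have [x1 x1s x1W] : exists2 x, x \in s & x - z \notin W.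
  apply: contrapT => nex; move: ltd; rewrite ltnNge => /negP; apply.
  apply: leq_trans (_ : \dim W <= _)%N.
    apply: dimvS; apply/span_subvP => u /mapP[x xs ->].
    by apply: contrapT => /negP xW; apply: nex; exists x.
  apply: leq_trans (dimv_add_leqif _ _) _.
  by rewrite dim_vline -[leqRHS]addn1 leq_add2l; case: (_ != _).
have [e [eW ex1]] := vspace_functional x1W.
have et x : x \in t -> ev e (x - z) = 0.
  by move=> xt; apply/eW/(subvP (addvSl _ _))/memv_span/map_f.
have ex0 : ev e (x0 - z) = 0 by apply/eW/(subvP (addvSr _ _))/memv_line.
pose f x := - ev c (x - z) / ev e (x - z).
have [x2] : exists2 x, x \in [seq x <- s | 0 < ev e (x - z)] &
    forall y, y \in [seq x <- s | 0 < ev e (x - z)] -> f x <= f y.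
  apply: seq_argmin; apply/eqP => s0.
  by have : x1 \in [::] by rewrite -s0 mem_filter ex1.
rewrite mem_filter => /andP[ex2 x2s] x2min.
have f2_ge0 : 0 <= f x2 by rewrite divr_ge0 ?(ltW ex2) ?oppr_ge0 ?cle.
exists (c + f x2 *: e); first split.
- move=> x xs; rewrite evDr evZr; have [ex|ex] := leP (ev e (x - z)) 0.
    by rewrite -[leRHS]addr0 lerD ?cle // mulr_ge0_le0.
  have := x2min x; rewrite mem_filter ex xs => /(_ isT).
  by rewrite /f ler_pdivlMr // => h; lra.
- by exists x0 => //; rewrite evDr evZr ex0 mulr0 addr0.
rewrite !size_filter; apply: (@count_lt _ _ _ _ x2) => //=.
- move=> x xs /= cx; rewrite evDr evZr (eqP cx) et ?mulr0 ?addr0 //.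
  by rewrite mem_filter cx.
- by rewrite evDr evZr /f mulfVK ?subrr // gt_eqF.
by apply/negP => cx2; move: ex2; rewrite et ?ltxx // mem_filter cx2.
Qed.

(** A supporting hyperplane with as many points of [s] as possible cannot be
    rotated further, so its face has codimension one. *)
Lemma supports_facet s z m :
    convex_hull [set` s] z -> has_dim (convex_hull [set` s]) m.+1 ->
    (exists c, supports s z c) ->
  exists2 F, facets (convex_hull [set` s]) F & F z.
Proof.
move=> Pz dimP [c1 sup1]; pose good n := `[< exists2 c, supports s z c & size (zeros s z c) = n >].
have exg : exists n, good n by exists (size (zeros s z c1)); apply/asboolP; exists c1.
have [n /asboolP[c sup zc] nmax] : exists2 n, good n & forall k, good k -> (k <= n)%N.
  case: (@ex_maxnP good (size s) exg) => [k /asboolP[c _ <-]|k gk kmax].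
    by rewrite size_filter count_size.
  by exists k.
have dimN : \dim <<directions z s>> = m.+1.
  by apply/(has_dim_span m.+1 Pz (@convex_hull_sub s) (@convex_hull_span z s)).
have dim_le : (m <= \dim <<directions z (zeros s z c)>>)%N.
  rewrite leqNgt; apply/negP => lt; have [|c' sup' lt'] := supports_rotate sup.
    by rewrite dimN ltnS.
  have /nmax : good (size (zeros s z c')) by apply/asboolP; exists c'.
  by rewrite leqNgt -zc lt'.
have [cle [x0 x0s cx0]] := sup.
have dim_lt : (\dim <<directions z (zeros s z c)>> < m.+1)%N.
  rewrite -dimN ltn_neqAle dimvS ?andbT; last first.
    by apply: sub_span => u /mapP[x]; rewrite mem_filter => /andP[_ xs] ->; exact: map_f.
  apply/negP => /eqP e; have : x0 - z \in <<directions z (zeros s z c)>>%VS.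
    have /eqP -> : (<<directions z (zeros s z c)>> == <<directions z s>>)%VS.
      rewrite eqEdim e leqnn andbT.
      by apply: sub_span => u /mapP[x]; rewrite mem_filter => /andP[_ xs] ->; exact: map_f.
    exact/memv_span/map_f.
  move=> /ev_span0 c0; move: cx0; rewrite c0 ?ltxx // => u /mapP[x].
  by rewrite mem_filter => /andP[/eqP cx _] ->.
pose F := [set x | convex_hull [set` s] x /\ ev c x = ev c z].
have ev_hull x : convex_hull [set` s] x -> ev c x <= ev c z.
  move=> [k [p [w [sp w0 w1 ->]]]].
  rewrite ev_sum -[ev c z]mul1r -w1 mulr_suml ler_sum // => i _.
  by rewrite evZ ler_wpM2l // -subr_le0 -evB cle //; exact: sp.
have Fz : F z by [].
exists F => //; split; first by exists c, (ev c z).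
exists m; split=> //; apply/(@has_dim_span F z (zeros s z c)) => //.
- move=> x; rewrite mem_filter evB subr_eq0 => /andP[/eqP xz xs].
  by split=> //; exact: convex_hull_sub.
- move=> x [[k [p [w [sp w0 w1 ->]]]] cx].
  have -> : \sum_i w i *: p i - z = \sum_i (w i *: (p i - z)).
    by under [RHS]eq_bigr do rewrite scalerBr; rewrite sumrB -scaler_suml w1 scale1r.
  apply: rpred_sum => i _; have si : p i \in s := sp i.
  (* Points off the face have weight zero, as all these terms are nonnegative. *)
  have : w i * - ev c (p i - z) = 0.
    have pos j : true -> 0 <= w j * - ev c (p j - z).
      by move=> _; rewrite mulr_ge0 // oppr_ge0 cle //; exact: sp.
    have : \sum_j w j * - ev c (p j - z) = 0.
      under eq_bigr do rewrite evB opprB mulrBr.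
      rewrite sumrB -mulr_suml w1 mul1r -cx ev_sum.
      by under eq_bigr do rewrite evZ; rewrite subrr.
    by move=> /eqP; rewrite psumr_eq0 // => /allP/(_ i (mem_index_enum _))/eqP.
  move/eqP; rewrite mulf_eq0 oppr_eq0 => /orP[/eqP->|pz]; first by rewrite scale0r mem0v.
  by apply/rpredZ/memv_span/map_f; rewrite mem_filter pz.
by apply/eqP; rewrite eqn_leq dim_le -ltnS dim_lt.
Qed.

(** If no hyperplane supports the polytope at [z] in a proper face, the vectors
    from [z] to the generating points satisfy a positive linear relation, by
    [stiemke], and [z] is an interior point. *)
Theorem boundary_in_facet P m z :
    polytope P -> has_dim P m.+1 -> P z -> ~ relative_interior P z ->
  exists2 F, facets P F & F z.
Proof.
move=> [A /finite_seqP[s ->] ->] dimP Pz nint; apply: (supports_facet Pz dimP).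
apply: contrapT => nsup; apply: nint.
have [|l l0 lz] := @stiemke R d (size s) (fun i => s`_i - z).
  move=> c cle i lti; apply/eqP; rewrite eq_le cle //= leNgt; apply/negP => ci.
  apply: nsup; exists c; split; last by exists s`_i; rewrite ?mem_nth.
  by move=> x xs; rewrite -(nth_index 0 xs) cle // index_mem.
exact: (relative_interior_positive Pz l0 lz).
Qed.

End Polytopes.

(** * Interior segments of the associahedron *)

Lemma cycle_nth (T : Type) (e : rel T) (x0 : T) (s : seq T) i :
  path.cycle e s -> (i < size s)%N -> e (nth x0 s i) (nth x0 s (i.+1 %% size s)).
Proof.
case: s => //= x p /(pathP x0) cyc lti; have := cyc i; rewrite size_rcons => /(_ lti).
rewrite -rcons_cons !nth_rcons lti; move: lti; rewrite ltnS leq_eqVlt.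
by case/predU1P=> [->|lt_ip]; rewrite ?ltnn ?eqxx ?modnn // lt_ip modn_small.
Qed.

Section Assembly.
Variables (R : realType) (d : nat).
Implicit Types (P F : set 'rV[R]_d) (x y z : 'rV[R]_d).

(** The maximum of a linear functional on a segment is attained inside only if
    the functional is constant. *)
Lemma face_open_segment P F x y z : face P F -> P x -> P y ->
  open_segment x y z -> F z -> F x /\ F y.
Proof.
move=> [c [b [le_b ->]]] Px Py [t t01 <-] [_ zb].
have := le_b _ Px; have := le_b _ Py; rewrite -!/(ev c _) in zb *.
rewrite /= in_itv /= in t01; have /andP[t0 t1] := t01.
rewrite -/(ev c _) evD !evZ in zb => yb xb.
have xE : ev c x = b by nra.
have yE : ev c y = b by nra.
by split; split.
Qed.

Lemma vertex_in P x : vertices P x -> P x.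
Proof. by move=> [c [b [_ e]]]; have : [set x] x by []; rewrite e => -[]. Qed.

End Assembly.

Lemma apart_open_segment (R : realType) (n d : nat) (P : set 'rV[R]_d)
    (vtx : {set {set 'I_n}} -> 'rV[R]_d) (fct : {set 'I_n} -> set 'rV[R]_d) (T T' : {set {set 'I_n}}) :
    (3 < n)%N -> polytope P -> has_dim P (n - 3) ->
    set_bij [set` triangulations n] (vertices P) vtx ->
    set_bij [set` diagonals n] (facets P) fct ->
    (forall (T : {set {set 'I_n}}) (D : {set 'I_n}),
            T \in triangulations n -> D \in diagonals n ->
            (fct D (vtx T) <-> D \in T)) ->
    T \in triangulations n -> T' \in triangulations n ->
    (forall D, D \in T -> D \notin T') ->
  open_segment (vtx T) (vtx T') `<=` relative_interior P.
Proof.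
move=> n3 polP dimP [vP _ _] [_ _ fS] inc tT tT' dTT' z zTT'.
have PT S : S \in triangulations n -> P (vtx S) by move=> tS; apply: vertex_in; exact: vP.
have Pz : P z.
  have [A _ eP] := polP; case: zTT' => t; rewrite /= in_itv /= => /andP[t0 t1] <-.
  by rewrite eP; apply: convex_hull_convex; rewrite -?eP ?(ltW t0) ?(ltW t1) //; apply: PT.
apply: contrapT => nz.
have dimS : has_dim P (n - 4).+1 by rewrite (_ : (n - 4).+1 = n - 3)%N //; clear -n3; lia.
have [F fF Fz] := boundary_in_facet polP dimS Pz nz.
have [D dD eF] := fS F fF; have [faceF _] := fF.
have [FT FT'] := face_open_segment faceF (PT _ tT) (PT _ tT') zTT' Fz.
rewrite -eF in FT FT'; move: FT FT' => /(inc _ _ tT dD) DT /(inc _ _ tT' dD) DT'.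
by have := dTT' _ DT; rewrite DT'.
Qed.

Theorem corollary1p2 (R : realType) (n d : nat) (P : set 'rV[R]_d)
    (hn : (5 <= n)%N) (hP : is_associahedron n P) :
  exists v : 'I_(catalan (n - 2)) -> 'rV[R]_d,
    set_bij [set: 'I_(catalan (n - 2))] (vertices P) v /\
    forall i : 'I_(catalan (n - 2)),
      open_segment (v i) (v (ordS i)) `<=` relative_interior P.
Proof.
have [polP dimP [vtx [fct [vbij fbij inc]]]] := hP.
have [c [Uc cc allc]] := hamiltonian_cycle hn.
have sz : size c = catalan (n - 2).
  rewrite -(@card_triangulations n) ?(leq_trans _ hn) //.
  have Uvc : uniq (map val c) by rewrite map_inj_uniq //; exact: val_inj.
  rewrite -(size_map val c) -(card_uniqP Uvc); apply: eq_card => T.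
  rewrite [in RHS]inE; apply/mapP/idP => [[u _ ->]|tT]; first exact: valP.
  by exists (Sub T tT) => //; exact: allc.
have tri (u : triangulation n) : val u \in triangulations n by rewrite inE; exact: valP.
pose u0 := fanV hn; pose w i := val (nth u0 c i).
exists (fun i : 'I_(catalan (n - 2)) => vtx (w i)); split.
  have [vF vI vS] := vbij; split.
  - by move=> i _; apply: vF; exact: tri.
  - move=> i j _ _ /vI; rewrite !inE => /(_ (tri _) (tri _)) /val_inj /eqP.
    by rewrite nth_uniq ?sz // => /eqP/val_inj.
  move=> x /vS[T tT <-]; rewrite /= inE in tT.
  have lt : (index (Sub T tT : triangulation n) c < catalan (n - 2))%N by rewrite -sz index_mem.
  by exists (Ordinal lt) => //; rewrite /w /= nth_index.
move=> i; apply: (apart_open_segment _ polP dimP vbij fbij inc); rewrite ?tri //.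
  by apply: (leq_trans _ hn).
move=> D Du; apply/negP => Dv.
have lti : (i < size c)%N by rewrite sz.
have := cycle_nth u0 cc lti; rewrite sz /apart => /disjointFr/(_ Du).
by rewrite -[_ \in _]/(D \in w (ordS i)) Dv.
Qed.
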